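(* The graph of primary degenerations of the variety $\mathfrak{Leib}_3$ of three-dimensional Leibniz algebras over $\mathbb{C}$ is the following directed graph. Its vertices are the isomorphism classes of three-dimensional Leibniz algebras over $\mathbb{C}$, which are represented by $$\mathbb{C}^3,\ \mathfrak{g}_1,\ \mathfrak{g}_2,\ \mathfrak{g}_3^{\alpha},\ \mathfrak{g}_4,\ \mathfrak{L}_1^{\beta},\ \mathfrak{L}_2,\ \mathfrak{L}_3,\ \mathfrak{L}_4^{\alpha},\ \mathfrak{L}_5,\ \mathfrak{L}_6^{\alpha},\ \mathfrak{L}_7,\ \mathfrak{L}_8,\ \mathfrak{L}_9\qquad(\alpha,\beta\in\mathbb{C}),$$ where parameter values giving isomorphic algebras define the same vertex. Its edges, i.e. all primary degenerations, are exactly the following: (1) $\mathfrak{L}_5\to\mathfrak{L}_4^{2}$; (2) $\mathfrak{L}_6^{\alpha}\to\mathfrak{L}_8$ for every $\alpha\in\mathbb{C}\setminus\{0,1\}$; (3) $\mathfrak{L}_7\to\mathfrak{L}_6^{1}$ and $\mathfrak{L}_7\to\mathfrak{L}_8$; (4) $\mathfrak{L}_9\to\mathfrak{L}_8$ and $\mathfrak{L}_9\to\mathfrak{L}_6^{0}$; (5) $\mathfrak{L}_4^{\alpha}\to\mathfrak{L}_1^{\beta}$ with $\beta=\frac{1-\alpha}{(2-\alpha)^2}$, for every $\alpha\in\mathbb{C}\setminus\{2\}$; (6) $\mathfrak{L}_4^{2}\to\mathfrak{L}_3$; (7) $\mathfrak{L}_4^{0}\to\mathfrak{g}_3^{0}$;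 (8) $\mathfrak{L}_8\to\mathfrak{L}_1^{0}$; (9) $\mathfrak{L}_6^{0}\to\mathfrak{L}_1^{0}$; (10) $\mathfrak{L}_6^{1}\to\mathfrak{L}_2$; (11) $\mathfrak{L}_1^{\beta}\to\mathfrak{L}_2$ for every $\beta\in\mathbb{C}$; (12) $\mathfrak{L}_1^{1/4}\to\mathfrak{g}_1$; (13) $\mathfrak{L}_3\to\mathfrak{L}_2$; (14) $\mathfrak{g}_4\to\mathfrak{g}_3^{-1}$; (15) $\mathfrak{g}_3^{\alpha}\to\mathfrak{g}_1$ for every $\alpha\in\mathbb{C}$; (16) $\mathfrak{g}_3^{1}\to\mathfrak{g}_2$; (17) $\mathfrak{L}_2\to\mathbb{C}^3$, $\mathfrak{g}_1\to\mathbb{C}^3$ and $\mathfrak{g}_2\to\mathbb{C}^3$. Thus, for three-dimensional Leibniz algebras $A$ and $B$ over $\mathbb{C}$, $A$ degenerates to $B$ if and only if there is a directed path (possibly of length zero) from the vertex of $A$ to the vertex of $B$ in this graph.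
   Context: All algebras are over $\mathbb{C}$; an algebra is a vector space with a bilinear product (not necessarily associative). A Leibniz algebra is an algebra satisfying the identity $(xy)z=(xz)y+x(yz)$. Let $V$ be a complex vector space of dimension $3$ with basis $e_1,e_2,e_3$. An algebra structure on $V$ is an element $\mu\in\mathrm{Hom}(V\otimes V,V)\cong\mathbb{C}^{27}$, with coordinates the structure constants $c_{i,j}^k$, $\mu(e_i\otimes e_j)=\sum_k c_{i,j}^k e_k$; this space carries the Zariski topology. The group $GL(V)$ acts by $(g*\mu)(x\otimes y)=g\mu(g^{-1}x\otimes g^{-1}y)$; $O(\mu)$ is the orbit of $\mu$, and orbits correspond to isomorphism classes of algebras. $\mathfrak{Leib}_3$ is the (Zariski closed, $GL(V)$-stable) set of Leibniz algebra structures on $V$. If algebras $A$, $B$ are represented by structures $\mu$, $\lambda$, then $A$ degenerates to $B$, written $A\to B$, if $\lambda\in\overline{O(\mu)}$ (Zariski closure); this does not depend on the choice of $\mu,\lambda$. A degeneration $A\to B$ is proper if $A\not\cong B$. A proper degeneration $A\to B$ is primary if there is no algebra $C$ such that $A\to C$ and $C\to B$ are both proper degenerations. $\mathbb{C}^3$ denotes the three-dimensional algebra with zero multiplication. Lie algebras (basis $e_1,e_2,e_3$; products of basis elements not listed are zero or follow from listed ones by anticommutativity): - $\mathfrak{g}_1$: $e_2e_3=e_1$; - $\mathfrak{g}_2$: $e_1e_3=e_1,\ e_2e_3=e_2$; - $\mathfrak{g}_3^{\alpha}$ ($\alpha\in\mathbb{C}$): $e_1e_3=e_1+e_2,\ e_2e_3=\alpha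 e_2$ (here $\mathfrak{g}_3^{\alpha}\cong\mathfrak{g}_3^{\beta}$ if $\alpha\beta=1$); - $\mathfrak{g}_4$: $e_1e_2=e_3,\ e_1e_3=-e_2,\ e_2e_3=e_1$. Non-Lie Leibniz algebras (basis $e_1,e_2,e_3$; all products of basis elements not listed are zero; $\alpha,\beta\in\mathbb{C}$): - $\mathfrak{L}_1^{\beta}$: $e_2e_2=\beta e_1,\ e_3e_2=e_1,\ e_3e_3=e_1$; - $\mathfrak{L}_2$: $e_3e_3=e_1$; - $\mathfrak{L}_3$: $e_2e_2=e_1,\ e_3e_3=e_1$; - $\mathfrak{L}_4^{\alpha}$: $e_1e_3=\alpha e_1,\ e_2e_3=e_2,\ e_3e_2=-e_2,\ e_3e_3=e_1$; - $\mathfrak{L}_5$: $e_1e_3=2e_1,\ e_2e_2=e_1,\ e_2e_3=e_2,\ e_3e_2=-e_2,\ e_3e_3=e_1$; - $\mathfrak{L}_6^{\alpha}$: $e_1e_3=\alpha e_1,\ e_2e_3=e_2$; - $\mathfrak{L}_7$: $e_1e_3=e_1+e_2,\ e_2e_3=e_2$; - $\mathfrak{L}_8$: $e_1e_3=e_2,\ e_3e_3=e_1$; - $\mathfrak{L}_9$: $e_1e_3=e_2,\ e_2e_3=e_2,\ e_3e_3=e_1$. *)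

(* Defs.v *)
From HB Require Import structures.
From mathcomp Require Import all_boot all_order all_algebra.
From mathcomp Require Import classical_sets reals complex mxtens mpoly.

Set Implicit Arguments.
Unset Strict Implicit.
Unset Printing Implicit Defensive.

Import GRing.Theory.
Local Open Scope ring_scope.
Local Open Scope classical_set_scope.

Section Structures.
Variable K : fieldType.

(* V is the space of column vectors.  The basis of V (x) V is (e_i (x) e_j),
   [x *t y] is the decomposable tensor x (x) y, and an algebra structure is the
   matrix of a linear map V (x) V -> V: the entry of A in row k and column
   [mxtens_index (i, j)] is the structure constant c_{i,j}^k. *)
Definition structure := 'M[K]_(3, 3 * 3).

Implicit Types (A B C : structure) (x y z : 'cV[K]_3) (X Z : set structure).

Definition amul A x y : 'cV[K]_3 := A *m (x *t y).

Definition leibniz A :=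
  forall x y z, amul A (amul A x y) z = amul A (amul A x z) y + amul A x (amul A y z).

Definition isomorphic A B :=
  exists2 g : 'M[K]_3, g \in unitmx
    & forall x y, g *m amul A x y = amul B (g *m x) (g *m y).

Definition gl_act (g : 'M[K]_3) A : structure := g *m A *m (invmx g *t invmx g).

Definition gl_orbit A : set structure :=
  [set gl_act g A | g in [set g : 'M[K]_3 | g \in unitmx]].

(* [mxvec A 0] is the vector of the 27 structure constants. *)
Definition zariski_closed Z :=
  exists P : set {mpoly K[3 * (3 * 3)]},
    Z = [set A | forall p, P p -> p.@[mxvec A 0] = 0].

Definition zariski_closure X : set structure := smallest zariski_closed X.

Definition degenerates A B := zariski_closure (gl_orbit A) B.

Definition proper_degeneration A B := degenerates A B /\ ~ isomorphic A B.

Definition primary_degeneration A B :=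
  proper_degeneration A B /\
  ~ exists C, proper_degeneration A C /\ proper_degeneration C B.

(* In a multiplication table, the entry (x, y, v), with x and y basis vectors,
   stands for the product xy = v.  The matrix [v *m (x *t y)^T] maps x (x) y
   to v and every other basis tensor to 0. *)
Definition table (s : seq ('cV[K]_3 * 'cV[K]_3 * 'cV[K]_3)) : structure :=
  \sum_(t <- s) t.2 *m (t.1.1 *t t.1.2)^T.

(* Each entry xy = v also contributes yx = - v. *)
Definition lie_table (s : seq ('cV[K]_3 * 'cV[K]_3 * 'cV[K]_3)) : structure :=
  \sum_(t <- s) t.2 *m (t.1.1 *t t.1.2 - t.1.2 *t t.1.1)^T.

Definition e1 : 'cV[K]_3 := delta_mx 0 0.
Definition e2 : 'cV[K]_3 := delta_mx 1 0.
Definition e3 : 'cV[K]_3 := delta_mx 2 0.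

(* The symbols naming the vertices; distinct symbols of one parametric family
   may name the same vertex. *)
Inductive symbol : Type :=
  | C3 | g1 | g2 | g3 of K | g4
  | L1 of K | L2 | L3 | L4 of K | L5 | L6 of K | L7 | L8 | L9.

Definition alg_of (s : symbol) : structure :=
  match s with
  | C3 => 0
  | g1 => lie_table [:: (e2, e3, e1)]
  | g2 => lie_table [:: (e1, e3, e1); (e2, e3, e2)]
  | g3 a => lie_table [:: (e1, e3, e1 + e2); (e2, e3, a *: e2)]
  | g4 => lie_table [:: (e1, e2, e3); (e1, e3, - e2); (e2, e3, e1)]
  | L1 b => table [:: (e2, e2, b *: e1); (e3, e2, e1); (e3, e3, e1)]
  | L2 => table [:: (e3, e3, e1)]
  | L3 => table [:: (e2, e2, e1); (e3, e3, e1)]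
  | L4 a => table [:: (e1, e3, a *: e1); (e2, e3, e2); (e3, e2, - e2);
                      (e3, e3, e1)]
  | L5 => table [:: (e1, e3, 2 *: e1); (e2, e2, e1); (e2, e3, e2);
                    (e3, e2, - e2); (e3, e3, e1)]
  | L6 a => table [:: (e1, e3, a *: e1); (e2, e3, e2)]
  | L7 => table [:: (e1, e3, e1 + e2); (e2, e3, e2)]
  | L8 => table [:: (e1, e3, e2); (e3, e3, e1)]
  | L9 => table [:: (e1, e3, e2); (e2, e3, e2); (e3, e3, e1)]
  end.

(* Forgets the parameter of a symbol. *)
Definition forget_param (s : symbol) : symbol :=
  match s with
  | g3 _ => g3 0 | L1 _ => L1 0 | L4 _ => L4 0 | L6 _ => L6 0
  | _ => s
  end.

Inductive listed : symbol -> symbol -> Prop :=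
  | L5_L4 : listed L5 (L4 2)
  | L6_L8 a : a != 0 -> a != 1 -> listed (L6 a) L8
  | L7_L6 : listed L7 (L6 1)
  | L7_L8 : listed L7 L8
  | L9_L8 : listed L9 L8
  | L9_L6 : listed L9 (L6 0)
  | L4_L1 a : a != 2 -> listed (L4 a) (L1 ((1 - a) / (2 - a) ^+ 2))
  | L4_L3 : listed (L4 2) L3
  | L4_g3 : listed (L4 0) (g3 0)
  | L8_L1 : listed L8 (L1 0)
  | L6_L1 : listed (L6 0) (L1 0)
  | L6_L2 : listed (L6 1) L2
  | L1_L2 b : listed (L1 b) L2
  | L1_g1 : listed (L1 4^-1) g1
  | L3_L2 : listed L3 L2
  | g4_g3 : listed g4 (g3 (-1))
  | g3_g1 a : listed (g3 a) g1
  | g3_g2 : listed (g3 1) g2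
  | L2_C3 : listed L2 C3
  | g1_C3 : listed g1 C3
  | g2_C3 : listed g2 C3.

(* The vertices are isomorphism classes, so the graph is given by relations
   between structures that depend only on their isomorphism classes. *)
Definition edge A B :=
  exists s t, [/\ listed s t, isomorphic A (alg_of s) & isomorphic B (alg_of t)].

Inductive directed_path : structure -> structure -> Prop :=
  | path_nil A B : isomorphic A B -> directed_path A B
  | path_cons A B C : edge A B -> directed_path B C -> directed_path A C.

End Structures.

Arguments C3 {K}.
Arguments g1 {K}.
Arguments g2 {K}.
Arguments g4 {K}.
Arguments L2 {K}.
Arguments L3 {K}.
Arguments L5 {K}.
Arguments L7 {K}.
Arguments L8 {K}.
Arguments L9 {K}.

(* Main.v *)
Require Import Defs.
From mathcomp Require Import all_boot all_order all_algebra.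
From mathcomp Require Import classical_sets boolp reals complex mxtens mpoly.
From mathcomp Require Import ring.

(** A degeneration from [A] to [B] means that every polynomial function of the
structure constants that vanishes on the orbit of [A] vanishes at [B]
([degeneratesP]); in particular degeneration is a preorder, and two arguments
decide it completely.

Degenerations come from curves.  If the structures B + t C + t^2 D are all
isomorphic to [A] for t nonzero, then [A] degenerates to [B]
([degenerates_curve]), because a polynomial in t with infinitely many zeros
vanishes at 0.  Each listed edge is realized by a basis of its source that depends
on t ([listed_degenerates]).

Nondegenerations come from identities.  Scalars built from nonassociative
monomials, linear forms and traces of multiplication operators are polynomial in
the structure and natural under isomorphisms, so an identity between them that
holds in [A] holds in every degeneration of [A] ([degenerates_satisfies]).  Most
of the identities used are classical (commutativity, nilpotency, spectrum of the
right multiplications).  The delicate one is [L4_pencil_law]: it retains, in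
the nilpotent limits of L4 with parameter a, the ratio between the left and right
actions on a limit plane, and so determines the parameter of the limit in the
family L1.  Evaluating the identities on the list shows that every degeneration
between listed algebras is in the table [reach] ([degenerates_reach]), and
conversely the table consists of paths of listed edges ([reach_path]).  Since no
vertex of the table lies strictly between the ends of an edge ([listed_between]),
the edges are exactly the primary degenerations.  As distinct families never reach
each other in both directions, the table also shows that they are not
isomorphic ([iso_forget_param]).

It remains to see that the list is complete ([leibniz_classified]).  In a Lie
algebra, either x y is always a combination of x and y, which forces
x y = f(y) x - f(x) y, or some x, y and z = x y form a basis, and the Jacobi identity
leaves a companion matrix (the solvable case) or an invertible traceless one (the
simple case).  In a Leibniz algebra that is not a Lie algebra, a nonzero square
u = a a belongs to the right annihilator.  If the latter is a plane, the algebra is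
determined by the action of [a] on it and by u; if it is the line of u, the
quotient by u is a Lie algebra of dimension two, and the cases where it is abelian
or not give a bilinear form and the families L4 and L5. *)

Set Implicit Arguments.
Unset Strict Implicit.
Unset Printing Implicit Defensive.

Import Order.TTheory GRing.Theory Num.Theory.
Local Open Scope ring_scope.

(** * Coordinates and products *)

Section Coordinates.
Variable K : fieldType.
Implicit Types (A B C : structure K) (x y z u v w : 'cV[K]_3).

Lemma ord3P (P : 'I_3 -> Prop) : P 0 -> P 1 -> P 2 -> forall i, P i.
Proof.
move=> P0 P1 P2 [[|[|[|//]]] lti].
- by rewrite (_ : Ordinal _ = 0) //; apply: val_inj.
- by rewrite (_ : Ordinal _ = 1) //; apply: val_inj.
- by rewrite (_ : Ordinal _ = 2) //; apply: val_inj.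
Qed.

Lemma sum3 (V : zmodType) (F : 'I_3 -> V) : \sum_i F i = F 0 + F 1 + F 2.
Proof.
rewrite 3!big_ord_recl big_ord0 addr0 addrA.
by congr (_ + F _ + F _); apply: val_inj.
Qed.

Lemma cV3P x y : x 0 0 = y 0 0 -> x 1 0 = y 1 0 -> x 2 0 = y 2 0 -> x = y.
Proof.
by move=> h0 h1 h2; apply/matrixP => i j; rewrite ord1; elim/ord3P: i.
Qed.

Lemma coordD x y i : (x + y) i 0 = x i 0 + y i 0.
Proof. by rewrite mxE. Qed.

Lemma coordN x i : (- x) i 0 = - x i 0.
Proof. by rewrite mxE. Qed.

Lemma coordZ c x i : (c *: x) i 0 = c * x i 0.
Proof. by rewrite mxE. Qed.

Lemma coord0 i : (0 : 'cV[K]_3) i 0 = 0.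
Proof. by rewrite mxE. Qed.

Lemma tens_cVE x y i : (x *t y : 'cV_(3 * 3)) i 0 =
  x (mxtens_unindex i).1 0 * y (mxtens_unindex i).2 0.
Proof. by rewrite mxE !ord1. Qed.

Lemma sum_tens (F : 'I_3 -> 'I_3 -> K) :
  \sum_i F (mxtens_unindex i).1 (mxtens_unindex i).2 = \sum_i \sum_j F i j.
Proof.
rewrite pair_bigA (reindex (@mxtens_unindex 3 3)) //=.
by exists (@mxtens_index 3 3) => i _; rewrite ?mxtens_indexK ?mxtens_unindexK.
Qed.

Lemma amulE A x y k : amul A x y k 0 =
  \sum_i A k i * (x (mxtens_unindex i).1 0 * y (mxtens_unindex i).2 0).
Proof. by rewrite mxE; apply: eq_bigr => i _; rewrite tens_cVE. Qed.

Lemma amulDl A x y z : amul A (x + y) z = amul A x z + amul A y z.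
Proof.
apply/matrixP=> k j; rewrite ord1 [RHS]mxE !amulE -big_split.
by apply: eq_bigr => i _; rewrite mxE mulrDl mulrDr.
Qed.

Lemma amulDr A x y z : amul A x (y + z) = amul A x y + amul A x z.
Proof.
apply/matrixP=> k j; rewrite ord1 [RHS]mxE !amulE -big_split.
by apply: eq_bigr => i _; rewrite mxE !mulrDr.
Qed.

Lemma amulZl A a x y : amul A (a *: x) y = a *: amul A x y.
Proof.
apply/matrixP=> k j; rewrite ord1 [RHS]mxE !amulE big_distrr.
by apply: eq_bigr => i _ /=; rewrite mxE -mulrA mulrCA.
Qed.

Lemma amulZr A a x y : amul A x (a *: y) = a *: amul A x y.
Proof.
apply/matrixP=> k j; rewrite ord1 [RHS]mxE !amulE big_distrr.
by apply: eq_bigr => i _ /=; rewrite mxE; ring.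
Qed.

Lemma amulNl A x y : amul A (- x) y = - amul A x y.
Proof. by rewrite -scaleN1r amulZl scaleN1r. Qed.

Lemma amulNr A x y : amul A x (- y) = - amul A x y.
Proof. by rewrite -scaleN1r amulZr scaleN1r. Qed.

Lemma amul0l A y : amul A 0 y = 0.
Proof. by rewrite -(scale0r 0) amulZl !scale0r. Qed.

Lemma amul0r A x : amul A x 0 = 0.
Proof. by rewrite -(scale0r 0) amulZr !scale0r. Qed.

Definition bilin := (amulDl, amulDr, amulZl, amulZr, amulNl, amulNr, amul0l, amul0r).

Lemma amulDA A B x y : amul (A + B) x y = amul A x y + amul B x y.
Proof. exact: mulmxDl. Qed.

Lemma amulZA a A x y : amul (a *: A) x y = a *: amul A x y.
Proof. by rewrite /amul scalemxAl. Qed.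

Lemma cV3_expand x : x = x 0 0 *: e1 K + x 1 0 *: e2 K + x 2 0 *: e3 K.
Proof. by apply: cV3P; rewrite !mxE /= !(mulr0, mulr1, addr0, add0r). Qed.

Definition evec (i : 'I_3) : 'cV[K]_3 := delta_mx i 0.

Lemma cV3_sum x : x = \sum_i x i 0 *: evec i.
Proof. by rewrite sum3 -cV3_expand. Qed.

Lemma amul_suml A (I : Type) (r : seq I) (f : I -> 'cV[K]_3) y :
  amul A (\sum_(i <- r) f i) y = \sum_(i <- r) amul A (f i) y.
Proof.
elim: r => [|i r IH]; last by rewrite !big_cons amulDl IH.
by rewrite !big_nil -(scale0r 0) amulZl !scale0r.
Qed.

Lemma amul_sumr A (I : Type) (r : seq I) (f : I -> 'cV[K]_3) x :
  amul A x (\sum_(i <- r) f i) = \sum_(i <- r) amul A x (f i).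
Proof.
elim: r => [|i r IH]; last by rewrite !big_cons amulDr IH.
by rewrite !big_nil -(scale0r 0) amulZr !scale0r.
Qed.

Lemma amul_expand A x y :
  amul A x y = \sum_i \sum_j (x i 0 * y j 0) *: amul A (evec i) (evec j).
Proof.
rewrite {1}(cV3_sum x) amul_suml; apply: eq_bigr => i _.
rewrite {1}(cV3_sum y) amul_sumr; apply: eq_bigr => j _.
by rewrite amulZl amulZr scalerA.
Qed.

Lemma structure_ext A B : (forall x y, amul A x y = amul B x y) -> A = B.
Proof.
move=> eqAB; apply/matrixP => k j; case: (mxtens_indexP j) => j1 j2.
have entryE C : amul C (evec j1) (evec j2) k 0 = C k (mxtens_index (j1, j2)).
  rewrite amulE (bigD1 (mxtens_index (j1, j2))) // big1 ?addr0.
    by rewrite mxtens_indexK !mxE !eqxx /= !mulr1 addr0.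
  move=> i ne; rewrite ![evec _ _ _]mxE !andbT.
  case: eqP => [e|_]; last by rewrite mul0r mulr0.
  case: eqP => [e'|_]; last by rewrite !mulr0.
  by rewrite -e -e' -surjective_pairing mxtens_unindexK eqxx in ne.
by rewrite -!entryE eqAB.
Qed.

Lemma amul_outer v u w x y :
  amul (v *m (u *t w)^T) x y = ((u^T *m x) 0 0 * (w^T *m y) 0 0) *: v.
Proof.
apply/matrixP => k j; rewrite ord1 amulE [RHS]mxE 2!mxE.
pose F i j := v k 0 * ((u i 0 * x i 0) * (w j 0 * y j 0)).
transitivity (\sum_i F (mxtens_unindex i).1 (mxtens_unindex i).2).
  by apply: eq_bigr => i _; rewrite mxE big_ord1 mxE tens_cVE /F; ring.
rewrite sum_tens.
have -> : \sum_i \sum_j F i j = v k 0 * ((\sum_i u i 0 * x i 0) * (\sum_j w j 0 * y j 0)).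
  rewrite big_distrlr mulr_sumr; apply: eq_bigr => i _.
  by rewrite mulr_sumr.
by rewrite mulrC; congr (_ * _ * _); apply: eq_bigr => i _; rewrite mxE.
Qed.

End Coordinates.

(* Identities between linear combinations of vectors, checked entry by entry. *)
Ltac vector := apply: cV3P; rewrite ?(coordD, coordN, coordZ, coord0); ring.

(** * Isomorphism *)

Section Isomorphism.
Variable K : fieldType.
Implicit Types (A B C : structure K) (x y z u v w : 'cV[K]_3) (g P : 'M[K]_3).

Lemma amul_table (s : seq ('cV[K]_3 * 'cV[K]_3 * 'cV[K]_3)) x y :
  amul (table s) x y =
  \sum_(t <- s) ((t.1.1^T *m x) 0 0 * (t.1.2^T *m y) 0 0) *: t.2.
Proof.
rewrite /table; elim: s => [|t s IH].
  by rewrite !big_nil /amul mul0mx.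
by rewrite !big_cons amulDA IH amul_outer.
Qed.

Lemma amul_lie_table (s : seq ('cV[K]_3 * 'cV[K]_3 * 'cV[K]_3)) x y :
  amul (lie_table s) x y =
  \sum_(t <- s) ((t.1.1^T *m x) 0 0 * (t.1.2^T *m y) 0 0
               - (t.1.2^T *m x) 0 0 * (t.1.1^T *m y) 0 0) *: t.2.
Proof.
rewrite /lie_table; elim: s => [|t s IH].
  by rewrite !big_nil /amul mul0mx.
rewrite !big_cons amulDA IH; congr (_ + _).
rewrite raddfB /= mulmxBr amulDA -scaleN1r amulZA !amul_outer.
by rewrite scalerA mulN1r -scalerDl.
Qed.

Lemma amul_act g A x y :
  amul (gl_act g A) x y = g *m amul A (invmx g *m x) (invmx g *m y).
Proof. by rewrite /amul /gl_act -!mulmxA tensmx_mul. Qed.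

Lemma isomorphicP A B :
  isomorphic A B <-> exists2 g, g \in unitmx & B = gl_act g A.
Proof.
split=> -[g gU gAB]; exists g => //.
  apply: structure_ext => x y.
  by rewrite amul_act gAB !mulKVmx.
by move=> x y; rewrite gAB amul_act !mulKmx.
Qed.

Lemma iso_refl A : isomorphic A A.
Proof. by exists 1%:M; [exact: unitmx1 | move=> x y; rewrite !mul1mx]. Qed.

Lemma iso_sym A B : isomorphic A B -> isomorphic B A.
Proof.
case=> g gU gAB; exists (invmx g); first by rewrite unitmx_inv.
by move=> x y; rewrite -{1}(mulKVmx gU x) -{1}(mulKVmx gU y) -gAB mulKmx.
Qed.

Lemma iso_trans A B C : isomorphic A B -> isomorphic B C -> isomorphic A C.
Proof.
case=> g gU gAB [h hU hBC]; exists (h *m g); first by rewrite unitmx_mul hU.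
by move=> x y; rewrite -mulmxA gAB hBC !mulmxA.
Qed.

End Isomorphism.

(** * Degeneration and polynomial functions *)

Section Zariski.
Local Open Scope classical_set_scope.
Variable K : fieldType.
Implicit Types (A B C : structure K) (x y z u v w : 'cV[K]_3) (g P : 'M[K]_3).

Definition polyfun (F : structure K -> K) :=
  exists p : {mpoly K[3 * (3 * 3)]}, forall A, F A = p.@[mxvec A 0].

Lemma polyfun_cst c : polyfun (fun=> c).
Proof. by exists c%:MP => A; rewrite mevalC. Qed.

Lemma polyfunD F G : polyfun F -> polyfun G -> polyfun (fun A => F A + G A).
Proof. by move=> [p Fp] [q Gq]; exists (p + q) => A; rewrite mevalD Fp Gq. Qed.

Lemma polyfunM F G : polyfun F -> polyfun G -> polyfun (fun A => F A * G A).
Proof. by move=> [p Fp] [q Gq]; exists (p * q) => A; rewrite mevalM Fp Gq. Qed.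

Lemma polyfun_entry k j : polyfun (fun A => A k j).
Proof. by exists 'X_(mxvec_index k j) => A; rewrite mevalXU mxvecE. Qed.

Lemma polyfun_sum (I : Type) (r : seq I) (F : I -> structure K -> K) :
  (forall i, polyfun (F i)) -> polyfun (fun A => \sum_(i <- r) F i A).
Proof.
move=> polyF; elim: r => [|i r IH].
  under eq_fun do rewrite big_nil; exact: polyfun_cst.
by under eq_fun do rewrite big_cons; apply: polyfunD.
Qed.

(** Evaluating a polynomial only uses ring operations on the entries.  This is
applied to polynomial functions of a structure, to compose them with the action
of a matrix, and to polynomial functions of a parameter, to restrict them to a
curve of structures. *)
Lemma meval_closed (T : Type) (S : (T -> K) -> Prop) (f : T -> structure K)
    (Sc : forall c, S (fun=> c))
    (SD : forall F G, S F -> S G -> S (fun t => F t + G t))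
    (SM : forall F G, S F -> S G -> S (fun t => F t * G t))
    (Sf : forall k j, S (fun t => f t k j)) (p : {mpoly K[3 * (3 * 3)]}) :
  S (fun t => p.@[mxvec (f t) 0]).
Proof.
under eq_fun do rewrite mevalE.
have Ssum (I : Type) (r : seq I) F : (forall i, S (F i)) ->
    S (fun t => \sum_(i <- r) F i t).
  move=> SF; elim: r => [|i r IH]; first by under eq_fun do rewrite big_nil.
  by under eq_fun do rewrite big_cons; apply: SD.
have Sprod (I : Type) (r : seq I) F : (forall i, S (F i)) ->
    S (fun t => \prod_(i <- r) F i t).
  move=> SF; elim: r => [|i r IH]; first by under eq_fun do rewrite big_nil.
  by under eq_fun do rewrite big_cons; apply: SM.
apply: Ssum => m; apply: (SM (fun=> _)) => //; apply: Sprod => i.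
have Sx : S (fun t => mxvec (f t) 0 i).
  by case/mxvec_indexP: i => k j; under eq_fun do rewrite mxvecE.
by elim: (m i) => [|e IH]; [exact: Sc | under eq_fun do rewrite exprS; exact: SM].
Qed.

Lemma polyfun_act F g : polyfun F -> polyfun (fun A => F (gl_act g A)).
Proof.
case=> p Fp; under eq_fun do rewrite Fp.
apply: meval_closed => [|||k j]; first exact: polyfun_cst.
- exact: polyfunD.
- exact: polyfunM.
rewrite /gl_act; under eq_fun do rewrite mxE.
apply: polyfun_sum => i; apply: polyfunM; last exact: polyfun_cst.
under eq_fun do rewrite mxE; apply: polyfun_sum => l.
by apply: polyfunM; [exact: polyfun_cst | exact: polyfun_entry].
Qed.

(** The Zariski closure of a set is cut out by all the polynomial functions that
vanish on the set. *)
Lemma degeneratesP A B :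
  degenerates A B <-> forall F, polyfun F ->
    (forall g, g \in unitmx -> F (gl_act g A) = 0) -> F B = 0.
Proof.
split=> [AB F [p Fp] FA | vanish Z [[P ZP] AZ]].
  have: [set C | F C = 0] B.
    apply: AB; split; last by move=> _ [g gU <-]; exact: FA.
    exists [set p]; apply/seteqP; split=> C /=.
      by move=> FC q ->; rewrite -Fp.
    by move=> /(_ p erefl); rewrite -Fp.
  by [].
rewrite ZP => p Pp; apply: (vanish (fun C => p.@[mxvec C 0])); first by exists p.
move=> g gU; have : Z (gl_act g A) by apply: AZ; exists g.
by rewrite ZP; apply.
Qed.

Lemma gl_actM g h A : h \in unitmx -> g \in unitmx ->
  gl_act g (gl_act h A) = gl_act (g *m h) A.
Proof.
move=> hU gU; apply: structure_ext => x y; rewrite !amul_act !mulmxA.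
have ginv : invmx (g *m h) = invmx h *m invmx g.
  by rewrite -!/(@GRing.inv _ _) invrM.
by rewrite ginv.
Qed.

Lemma iso_degenerates A B : isomorphic A B -> degenerates A B.
Proof. by case/isomorphicP=> g gU ->; apply/degeneratesP => F _; apply. Qed.

(** A function that vanishes on the orbit of [A] still does after composition
with the action of a matrix, so it vanishes on the whole orbit of [B]. *)
Lemma degenerates_trans A B C :
  degenerates A B -> degenerates B C -> degenerates A C.
Proof.
move=> /degeneratesP AB /degeneratesP BC; apply/degeneratesP => F polyF FA.
apply: BC => // g gU; apply: (AB (fun D => F (gl_act g D))).
  exact: polyfun_act.
by move=> h hU; rewrite gl_actM //; apply: FA; rewrite unitmx_mul gU.
Qed.
End Zariski.

Section Curves.
Variable K : numFieldType.

Lemma poly_eq0_nonzero (q : {poly K}) : (forall t, t != 0 -> q.[t] = 0) -> q = 0.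
Proof.
move=> q0; apply: contraTeq isT => nzq.
have := max_poly_roots nzq (rs := [seq i.+1%:R | i <- iota 0 (size q)]).
rewrite size_map size_iota ltnn; apply.
  by apply/allP => _ /mapP[i _ ->]; apply/rootP/q0; rewrite pnatr_eq0.
rewrite map_inj_uniq ?iota_uniq // => i j /eqP.
by rewrite eqr_nat => /eqP[].
Qed.

(** Along the curve, a function that vanishes on the orbit of [A] is a univariate
polynomial with infinitely many zeros, so it also vanishes at the point [B] of
the curve. *)
Lemma degenerates_curve (A B C D : structure K) :
  (forall t, t != 0 -> isomorphic A (B + t *: C + t ^+ 2 *: D)) ->
  degenerates A B.
Proof.
move=> isoA; apply/degeneratesP => F [p Fp] FA.
pose f t := B + t *: C + t ^+ 2 *: D.
pose S G := exists q : {poly K}, forall t : K, G t = q.[t].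
have [q Fq] : S (fun t => p.@[mxvec (f t) 0]).
  apply: meval_closed => [c | G H [q Gq] [r Hr] | G H [q Gq] [r Hr] | k j].
  - by exists c%:P => t; rewrite hornerC.
  - by exists (q + r) => t; rewrite hornerD Gq Hr.
  - by exists (q * r) => t; rewrite hornerM Gq Hr.
  exists ((B k j)%:P + C k j *: 'X + D k j *: 'X^2) => t.
  by rewrite !hornerD !hornerZ hornerC hornerX hornerXn /f !mxE; ring.
have q0 : q = 0.
  apply: poly_eq0_nonzero => t t0; rewrite -Fq -Fp.
  by have /isomorphicP[g gU fE] := isoA t t0; rewrite /f fE FA.
have -> : B = f 0 by rewrite /f scale0r expr0n scale0r !addr0.
by rewrite Fp Fq q0 horner0.
Qed.
End Curves.

(** * Computing with structures in coordinates *)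

Section Tables.
Variable K : fieldType.
Implicit Types (A B C : structure K) (u v w x y z : K * K * K).

Definition vec x : 'cV[K]_3 := \col_i nth 0 [:: x.1.1; x.1.2; x.2] i.

Definition coords (x : 'cV[K]_3) : K * K * K := (x 0 0, x 1 0, x 2 0).

Lemma vecE x : (vec x 0 0 = x.1.1) * (vec x 1 0 = x.1.2) * (vec x 2 0 = x.2).
Proof. by rewrite !mxE. Qed.

Lemma coordsK : cancel coords vec.
Proof. by move=> x; apply: cV3P; rewrite vecE. Qed.

Lemma vecK : cancel vec coords.
Proof. by move=> [[a b] c]; rewrite /coords !vecE. Qed.

(** Products are described by functions on triples of scalars, which reduce by
computation: comparing two structures then amounts to comparing polynomials in
the coordinates. *)
Definition computes A (f : K * K * K -> K * K * K -> K * K * K) :=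
  forall x y, amul A (vec x) (vec y) = vec (f x y).

Definition add3 x y := (x.1.1 + y.1.1, x.1.2 + y.1.2, x.2 + y.2).
Definition scale3 a x := (a * x.1.1, a * x.1.2, a * x.2).
Definition entry3 (i : nat) x := if i is i'.+1 then if i' is 0 then x.1.2 else x.2 else x.1.1.

Lemma vec_add x y : vec (add3 x y) = vec x + vec y.
Proof. by apply: cV3P; rewrite !mxE. Qed.

Lemma vec_scale a x : vec (scale3 a x) = a *: vec x.
Proof. by apply: cV3P; rewrite !mxE. Qed.

Lemma vec0 : vec (0, 0, 0) = 0.
Proof. by apply: cV3P; rewrite !mxE. Qed.

Lemma computes_add A B f g : computes A f -> computes B g ->
  computes (A + B) (fun x y => add3 (f x y) (g x y)).
Proof. by move=> Af Bg x y; rewrite amulDA Af Bg vec_add. Qed.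

Lemma computes_scale a A f : computes A f ->
  computes (a *: A) (fun x y => scale3 a (f x y)).
Proof. by move=> Af x y; rewrite amulZA Af vec_scale. Qed.

(** The entry [(i, j, v)] stands for e_(i+1) e_(j+1) = v.  Positions are natural
numbers, and not ordinals, so that [tab_prod] reduces on explicit tables. *)
Definition tab (s : seq (nat * nat * (K * K * K))) : structure K :=
  table [seq (@evec K (inord t.1.1), @evec K (inord t.1.2), vec t.2) | t <- s].

Fixpoint tab_prod (s : seq (nat * nat * (K * K * K))) x y : K * K * K :=
  if s is t :: s' then
    add3 (scale3 (entry3 t.1.1 x * entry3 t.1.2 y) t.2) (tab_prod s' x y)
  else (0, 0, 0).

Lemma dot_basis i (x : 'cV[K]_3) : ((@evec K i)^T *m x) 0 0 = x i 0.
Proof. by rewrite trmx_delta -rowE mxE. Qed.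

Lemma entry_vec i x : (i < 3)%N -> vec x (inord i) 0 = entry3 i x.
Proof. by move=> lti; rewrite mxE inordK //; case: i lti => [|[|[|]]]. Qed.

Lemma tabP s : all (fun t => (t.1.1 < 3) && (t.1.2 < 3))%N s ->
  computes (tab s) (tab_prod s).
Proof.
move=> ok x y; rewrite /tab amul_table big_map.
elim: s ok => [|t s IH] /=; first by rewrite big_nil vec0.
case/andP=> /andP[lt1 lt2] ok.
by rewrite big_cons IH // vec_add vec_scale !dot_basis !entry_vec.
Qed.

Definition prod_of (s : symbol K) x y : K * K * K :=
  let: (x1, x2, x3) := x in let: (y1, y2, y3) := y in
  match s with
  | C3 => (0, 0, 0)
  | g1 => (x2 * y3 - x3 * y2, 0, 0)
  | g2 => (x1 * y3 - x3 * y1, x2 * y3 - x3 * y2, 0)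
  | g3 a => (x1 * y3 - x3 * y1, x1 * y3 - x3 * y1 + a * (x2 * y3 - x3 * y2), 0)
  | g4 => (x2 * y3 - x3 * y2, x3 * y1 - x1 * y3, x1 * y2 - x2 * y1)
  | L1 b => (b * x2 * y2 + x3 * y2 + x3 * y3, 0, 0)
  | L2 => (x3 * y3, 0, 0)
  | L3 => (x2 * y2 + x3 * y3, 0, 0)
  | L4 a => (a * x1 * y3 + x3 * y3, x2 * y3 - x3 * y2, 0)
  | L5 => (2 * x1 * y3 + x2 * y2 + x3 * y3, x2 * y3 - x3 * y2, 0)
  | L6 a => (a * x1 * y3, x2 * y3, 0)
  | L7 => (x1 * y3, x1 * y3 + x2 * y3, 0)
  | L8 => (x3 * y3, x1 * y3, 0)
  | L9 => (x3 * y3, x1 * y3 + x2 * y3, 0)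
  end.

Lemma alg_prod s : computes (alg_of s) (prod_of s).
Proof.
move=> [[x1 x2] x3] [[y1 y2] y3].
by case: s => [|||a||b|||a||a|||]; apply: cV3P; rewrite /alg_of;
   rewrite ?amul_table ?amul_lie_table ?big_cons ?big_nil /= ?dot_basis
           ?[amul 0 _ _]mul0mx /prod_of !mxE /=; ring.
Qed.

Definition comb u v w x :=
  add3 (scale3 x.1.1 u) (add3 (scale3 x.1.2 v) (scale3 x.2 w)).

Definition det3 u v w :=
  u.1.1 * (v.1.2 * w.2 - v.2 * w.1.2)
  - v.1.1 * (u.1.2 * w.2 - u.2 * w.1.2)
  + w.1.1 * (u.1.2 * v.2 - u.2 * v.1.2).

Definition cols3 u v w : 'M[K]_3 := \matrix_(i, j) vec (nth (0, 0, 0) [:: u; v; w] j) i 0.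

Lemma cols3_mul u v w x : cols3 u v w *m vec x = vec (comb u v w x).
Proof.
rewrite /comb !vec_add !vec_scale.
by apply/matrixP => i j; rewrite ord1 mxE sum3 !mxE /=; ring.
Qed.

Lemma cols3_unit u v w : det3 u v w != 0 -> cols3 u v w \in unitmx.
Proof.
move=> nzd; pose cross x y : K * K * K := (x.1.2 * y.2 - x.2 * y.1.2,
  x.2 * y.1.1 - x.1.1 * y.2, x.1.1 * y.1.2 - x.1.2 * y.1.1).
pose adj := (cols3 (cross v w) (cross w u) (cross u v))^T.
suff : ((det3 u v w)^-1 *: adj) *m cols3 u v w = 1%:M by case/mulmx1_unit.
apply/matrixP => i j; rewrite -scalemxAl !mxE sum3; move: nzd; rewrite /det3 => nzd.
by elim/ord3P: i; elim/ord3P: j; rewrite !mxE /=; field.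
Qed.

Lemma coordinates u v w x : det3 u v w != 0 -> exists y, x = comb u v w y.
Proof.
move=> /cols3_unit U; exists (coords (invmx (cols3 u v w) *m vec x)).
by apply: (can_inj vecK); rewrite -cols3_mul coordsK mulKVmx.
Qed.

(** The vectors [u], [v], [w] form a basis of [A] in which the multiplication
is that of [B]. *)
Lemma iso_comb A B f g u v w : computes A f -> computes B g -> det3 u v w != 0 ->
  (forall x y, f (comb u v w x) (comb u v w y) = comb u v w (g x y)) ->
  isomorphic A B.
Proof.
move=> Af Bg nzd fg; apply: iso_sym; exists (cols3 u v w); first exact: cols3_unit.
by move=> x y; rewrite -(coordsK x) -(coordsK y) Bg !cols3_mul Af fg.
Qed.

End Tables.

(* Reduces an equality of products in two bases to its three coordinates. *)
Ltac products :=
  let x1 := fresh "x1" in let x2 := fresh "x2" in let x3 := fresh "x3" in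
  let y1 := fresh "y1" in let y2 := fresh "y2" in let y3 := fresh "y3" in
  move=> [[x1 x2] x3] [[y1 y2] y3];
  rewrite /comb /= /add3 /scale3 /=; congr (_, _, _).

(** * The listed degenerations *)

Section Edges.
Variable K : numClosedFieldType.
Implicit Types (A B C : structure K) (u v w : K * K * K).

(** For every nonzero [t], the vectors [u t], [v t], [w t] form a basis of
[alg_of s] with determinant [h t], in which the multiplication is that of [B]
perturbed by [t] times the table [c] and [t ^+ 2] times the table [d]. *)
Lemma degenerates_along (s : symbol K) B f (c d : seq (nat * nat * (K * K * K)))
    (u v w : K -> K * K * K) (h : K -> K) :
  computes B f ->
  all (fun t => (t.1.1 < 3) && (t.1.2 < 3))%N (c ++ d) ->
  (forall t, t != 0 -> h t != 0) ->
  (forall t, t != 0 -> det3 (u t) (v t) (w t) = h t) ->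
  (forall t, t != 0 -> forall x y,
     prod_of s (comb (u t) (v t) (w t) x) (comb (u t) (v t) (w t) y) =
     comb (u t) (v t) (w t) (add3 (add3 (f x y) (scale3 t (tab_prod c x y)))
       (scale3 (t ^+ 2) (tab_prod d x y)))) ->
  degenerates (alg_of s) B.
Proof.
move=> Bf; rewrite all_cat => /andP[okc okd] hnz detE prodE.
apply: (degenerates_curve (C := tab c) (D := tab d)) => t nzt.
apply: (iso_comb (u := u t) (v := v t) (w := w t) (alg_prod s) _ _ (prodE t nzt)).
  by apply: computes_add; [apply: computes_add => //|]; apply: computes_scale; apply: tabP.
by rewrite detE // hnz.
Qed.

Lemma iso_L6 (a b : K) : a * b = 1 -> isomorphic (alg_of (L6 a)) (alg_of (L6 b)).
Proof.
move=> ab1; have nza : a != 0 by apply: contra_eq_neq ab1 => ->; rewrite mul0r eq_sym oner_eq0.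
have {ab1} -> : b = a^-1 by apply: (mulfI nza); rewrite ab1 divff.
apply: (iso_comb (u := (0, 1, 0)) (v := (1, 0, 0)) (w := (0, 0, a^-1)) (alg_prod _) (alg_prod _)).
  suff -> : det3 (0, 1, 0) (1, 0, 0) (0, 0, a^-1) = - a^-1 by rewrite oppr_eq0 invr_neq0.
  by rewrite /det3 /=; ring.
by products; field.
Qed.

(** Right multiplication by e_3 has the eigenvalues 1 and a on the span of e_1
and e_2, and only their ratio, up to exchange, matters. *)
Lemma iso_g3 (a b : K) : a * b = 1 -> isomorphic (alg_of (g3 a)) (alg_of (g3 b)).
Proof.
move=> ab1; have nza : a != 0 by apply: contra_eq_neq ab1 => ->; rewrite mul0r eq_sym oner_eq0.
have {ab1} -> : b = a^-1 by apply: (mulfI nza); rewrite ab1 divff.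
have [->|a1] := eqVneq a 1; first by rewrite invr1; exact: iso_refl.
have nz1a : 1 - a != 0 by rewrite subr_eq0 eq_sym.
apply: (iso_comb (u := (a / (1 - a), 0, 0)) (v := (1, (1 - a)^-1, 0)) (w := (0, 0, a^-1))
  (alg_prod _) (alg_prod _)).
  suff -> : det3 (a / (1 - a), 0, 0) (1, (1 - a)^-1, 0) (0, 0, a^-1) = (1 - a)^-2.
    by rewrite invr_neq0 // expf_neq0.
  by rewrite /det3 /=; field; rewrite ?nza ?nz1a.
by products; field; rewrite ?nza ?nz1a.
Qed.

Lemma degenerates_L5_L4 : degenerates (alg_of L5) (alg_of (L4 (2 : K))).
Proof.
apply: (degenerates_along (c := [::]) (d := [:: (1, 1, (1, 0, 0))])
  (u := fun t => (1, 0, 0)) (v := fun t => (0, t, 0)) (w := fun t => (0, 0, 1))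
  (h := fun t => t) (alg_prod _)) => // t nzt.
- by rewrite /det3 /=; ring.
- by products; ring.
Qed.

(** The vector e_3 acts on the span of e_1 and e_2 by a nonscalar invertible
operator T, of which p = e_1 + e_2 is a cyclic vector.  The basis is w = p + t e_3,
w w = t T p and (w w) w = t^2 T^2 p, in which t T tends to a nilpotent Jordan
block.  The basis w, w w, (w w) w also gives L7 -> L8, with p = e_1, and
L9 -> L8, with p = 0. *)
Lemma degenerates_L6_L8 (a : K) : a != 0 -> a != 1 ->
  degenerates (alg_of (L6 a)) (alg_of L8).
Proof.
move=> nza a1; apply: (degenerates_along (c := [:: (1, 2, (0, 1 + a, 0))]) (d := [:: (1, 2, (- a, 0, 0))])
  (u := fun t => (t * a, t, 0)) (v := fun t => (t ^+ 2 * a ^+ 2, t ^+ 2, 0)) (w := fun t => (1, 1, t))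
  (h := fun t => t ^+ 4 * (a * (1 - a))) (alg_prod _)) => // t nzt.
- by rewrite !mulf_neq0 ?expf_neq0 // subr_eq0 eq_sym.
- by rewrite /det3 /=; ring.
- by products; ring.
Qed.

Lemma degenerates_L7_L8 : degenerates (alg_of (@L7 K)) (alg_of L8).
Proof.
apply: (degenerates_along (c := [:: (1, 2, (0, 2, 0))]) (d := [:: (1, 2, (- 1, 0, 0))])
  (u := fun t => (t, t, 0)) (v := fun t => (t ^+ 2, 2 * t ^+ 2, 0)) (w := fun t => (1, 0, t))
  (h := fun t => t ^+ 4) (alg_prod _)) => // t nzt.
- by rewrite expf_neq0.
- by rewrite /det3 /=; ring.
- by products; ring.
Qed.

Lemma degenerates_L7_L6 : degenerates (alg_of L7) (alg_of (L6 (1 : K))).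
Proof.
apply: (degenerates_along (c := [:: (0, 2, (0, 1, 0))]) (d := [::])
  (u := fun t => (t, 0, 0)) (v := fun t => (0, 1, 0)) (w := fun t => (0, 0, 1))
  (h := fun t => t) (alg_prod _)) => // t nzt.
- by rewrite /det3 /=; ring.
- by products; ring.
Qed.

Lemma degenerates_L9_L8 : degenerates (alg_of (@L9 K)) (alg_of L8).
Proof.
apply: (degenerates_along (c := [:: (1, 2, (0, 1, 0))]) (d := [::])
  (u := fun t => (t ^+ 2, 0, 0)) (v := fun t => (0, t ^+ 3, 0)) (w := fun t => (0, 0, t))
  (h := fun t => t ^+ 6) (alg_prod _)) => // t nzt.
- by rewrite expf_neq0.
- by rewrite /det3 /=; ring.
- by products; ring.
Qed.

(** In L9, e_1 - e_2 is killed by right multiplications, and the square of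
e_3 - e_2 is e_1 - e_2, which becomes small when e_1 - e_2 is scaled by t^-1. *)
Lemma degenerates_L9_L6 : degenerates (alg_of L9) (alg_of (L6 (0 : K))).
Proof.
apply: (degenerates_along (c := [:: (2, 2, (1, 0, 0))]) (d := [::])
  (u := fun t => (t^-1, - t^-1, 0)) (v := fun t => (0, 1, 0)) (w := fun t => (0, - 1, 1))
  (h := fun t => t^-1) (alg_prod _)) => // t nzt.
- by rewrite invr_neq0 ?expf_neq0.
- by rewrite /det3 /=; ring.
- by products; field.
Qed.

(** On the plane J spanned by e_1 and e_2, whose products vanish, e_3 acts on the
right by diag(a, 1) and on the left by diag(0, -1).  In a basis adapted to a
vector p of J outside the two axes, these operators, scaled by t, tend to
(a - 1) N and N for one nilpotent N.  In the limit, p is isotropic with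
p z = (a - 1) (z p), and this ratio determines the parameter of L1. *)
Lemma degenerates_L4_L1 (a : K) : a != 2 ->
  degenerates (alg_of (L4 a)) (alg_of (L1 ((1 - a) / (2 - a) ^+ 2))).
Proof.
move=> a2; have nz : 2 - a != 0 by rewrite subr_eq0 eq_sym.
(* e_2 + r e_3 is the isotropic vector of L1 coming from J *)
pose r := - (1 - a) / (2 - a).
apply: (degenerates_along (c :=
  [:: (2, 2, (0, 2 - a, (2 - a) * r)); (2, 1, (0, 1 - a, (1 - a) * r));
      (1, 2, (0, 1, r)); (1, 1, (0, - r, - r * r));
      (0, 2, (1, 0, 0)); (2, 0, (- 1, 0, 0));
      (0, 1, (- r, 0, 0)); (1, 0, (r, 0, 0))]) (d := [::])
  (u := fun t => (0, (a - 2) * t, 0)) (v := fun t => (t / (2 - a), 1, - r * t))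
  (w := fun t => (0, 0, t)) (h := fun t => t ^+ 3) (alg_prod _)) => // t nzt.
- by rewrite expf_neq0.
- by rewrite /det3 /=; field.
- by products; rewrite /r; field.
Qed.

Lemma iso_L3 : isomorphic (tab [:: (1, 2, (1, 0, 0)); (2, 1, (1, 0, 0))]) (alg_of (@L3 K)).
Proof.
have i2 : 'i * 'i = -1 :> K by rewrite -expr2 sqrCi.
apply: (iso_comb (u := (2, 0, 0)) (v := (0, 1, 1)) (w := (0, 'i, - 'i)) _ (alg_prod _)).
- exact: tabP.
- suff -> : det3 (2, 0, 0) (0, 1, 1) (0, 'i, - 'i) = - 4 * 'i :> K.
    by rewrite mulf_neq0 ?oppr_eq0 ?neq0Ci ?pnatr_eq0.
  by rewrite /det3 /=; ring.
- by products; ring: i2.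
Qed.

(** A curve similar to that of L4 -> L1.  For a = 2, the left and right actions
have the same limit, so the limit is commutative. *)
Lemma degenerates_L4_L3 : degenerates (alg_of (L4 (2 : K))) (alg_of L3).
Proof.
apply: degenerates_trans (iso_degenerates iso_L3).
apply: (degenerates_along (c := [:: (1, 2, (0, 2, 0)); (2, 2, (1, 0, 0)); (0, 2, (1, 0, 0)); (2, 0, (- 1, 0, 0))]) (d := [:: (2, 2, (0, 1, 0))])
  (u := fun t => (0, - t, 0)) (v := fun t => (1, 1, 0)) (w := fun t => (0, 0, t))
  (h := fun t => t ^+ 2) (tabP _)) => // t nzt.
- by rewrite expf_neq0.
- by rewrite /det3 /=; ring.
- by products; ring.
Qed.

Lemma iso_g3_0 :
  isomorphic (tab [:: (1, 2, (0, 1, 0)); (2, 1, (0, - 1, 0))]) (alg_of (g3 (0 : K))).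
Proof.
apply: (iso_comb (u := (1, 1, 0)) (v := (- 1, 0, 0)) (w := (0, 0, 1)) _ (alg_prod _)).
- exact: tabP.
- suff -> : det3 (1, 1, 0) (- 1, 0, 0) (0, 0, 1) = 1 :> K by rewrite oner_eq0.
  by rewrite /det3 /=; ring.
- by products; ring.
Qed.

Lemma degenerates_L4_g3 : degenerates (alg_of (L4 (0 : K))) (alg_of (g3 0)).
Proof.
apply: degenerates_trans (iso_degenerates iso_g3_0).
apply: (degenerates_along (c := [:: (2, 2, (1, 0, 0))]) (d := [::])
  (u := fun t => (t^-1, 0, 0)) (v := fun t => (0, 1, 0)) (w := fun t => (0, 0, 1))
  (h := fun t => t^-1) (tabP _)) => // t nzt.
- by rewrite invr_neq0 ?expf_neq0.
- by rewrite /det3 /=; ring.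
- by products; field.
Qed.

Lemma iso_L1_0 : isomorphic (tab [:: (0, 2, (0, 1, 0))]) (alg_of (L1 (0 : K))).
Proof.
apply: (iso_comb (u := (0, 1, 0)) (v := (0, 0, 1)) (w := (1, 0, 1)) _ (alg_prod _)).
- exact: tabP.
- suff -> : det3 (0, 1, 0) (0, 0, 1) (1, 0, 1) = 1 :> K by rewrite oner_eq0.
  by rewrite /det3 /=; ring.
- by products; ring.
Qed.

Lemma degenerates_L8_L1 : degenerates (alg_of L8) (alg_of (L1 (0 : K))).
Proof.
apply: degenerates_trans (iso_degenerates iso_L1_0).
apply: (degenerates_along (c := [:: (2, 2, (1, 0, 0))]) (d := [::])
  (u := fun t => (t^-1, 0, 0)) (v := fun t => (0, t^-1, 0)) (w := fun t => (0, 0, 1))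
  (h := fun t => t^-2) (tabP _)) => // t nzt.
- by rewrite invr_neq0 ?expf_neq0.
- by rewrite /det3 /=; field.
- by products; field.
Qed.

Lemma degenerates_L6_L1 : degenerates (alg_of (L6 0)) (alg_of (L1 (0 : K))).
Proof.
apply: degenerates_trans (iso_degenerates iso_L1_0).
apply: (degenerates_along (c := [:: (1, 2, (0, 1, 0))]) (d := [::])
  (u := fun t => (1, 1, 0)) (v := fun t => (0, t, 0)) (w := fun t => (0, 0, t))
  (h := fun t => t ^+ 2) (tabP _)) => // t nzt.
- by rewrite expf_neq0.
- by rewrite /det3 /=; ring.
- by products; ring.
Qed.

Lemma degenerates_L6_L2 : degenerates (alg_of (L6 (1 : K))) (alg_of L2).
Proof.
apply: (degenerates_along (c := [:: (0, 2, (1, 0, 0)); (1, 2, (0, 1, 0))]) (d := [::])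
  (u := fun t => (t, 0, 0)) (v := fun t => (0, 1, 0)) (w := fun t => (1, 0, t))
  (h := fun t => t ^+ 2) (alg_prod _)) => // t nzt.
- by rewrite expf_neq0.
- by rewrite /det3 /=; ring.
- by products; ring.
Qed.

Lemma degenerates_L1_L2 (b : K) : degenerates (alg_of (L1 b)) (alg_of L2).
Proof.
apply: (degenerates_along (c := [:: (2, 1, (1, 0, 0))]) (d := [:: (1, 1, (b, 0, 0))])
  (u := fun t => (1, 0, 0)) (v := fun t => (0, t, 0)) (w := fun t => (0, 0, 1))
  (h := fun t => t) (alg_prod _)) => // t nzt.
- by rewrite /det3 /=; ring.
- by products; ring.
Qed.

(** The symmetric part of the form of L1 with parameter 1/4 is degenerate.  The
limit only keeps its kernel, spanned by e_2 - e_3/2, paired with e_3 by the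
alternating part. *)
Lemma degenerates_L1_g1 : degenerates (alg_of (L1 (4^-1 : K))) (alg_of g1).
Proof.
apply: (degenerates_along (c := [:: (2, 2, (- 2, 0, 0))]) (d := [::])
  (u := fun t => (- t / 2, 0, 0)) (v := fun t => (0, 1, - 2^-1)) (w := fun t => (0, 0, t))
  (h := fun t => - t ^+ 2 / 2) (alg_prod _)) => // t nzt.
- by rewrite mulf_neq0 ?oppr_eq0 ?expf_neq0 ?invr_neq0 ?pnatr_eq0.
- by rewrite /det3 /=; field.
- by products; field.
Qed.

Lemma degenerates_L3_L2 : degenerates (alg_of (@L3 K)) (alg_of L2).
Proof.
apply: (degenerates_along (c := [::]) (d := [:: (1, 1, (1, 0, 0))])
  (u := fun t => (1, 0, 0)) (v := fun t => (0, t, 0)) (w := fun t => (0, 0, 1))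
  (h := fun t => t) (alg_prod _)) => // t nzt.
- by rewrite /det3 /=; ring.
- by products; ring.
Qed.

Lemma iso_g3_N1 : isomorphic
  (tab [:: (0, 2, (1, 0, 0)); (2, 0, (- 1, 0, 0)); (1, 2, (0, - 1, 0)); (2, 1, (0, 1, 0))])
  (alg_of (g3 (- 1 : K))).
Proof.
apply: (iso_comb (u := (1, - 2^-1, 0)) (v := (0, 1, 0)) (w := (0, 0, 1)) _ (alg_prod _)).
- exact: tabP.
- suff -> : det3 (1, - 2^-1, 0) (0, 1, 0) (0, 0, 1) = 1 :> K by rewrite oner_eq0.
  by rewrite /det3 /=; field.
- by products; field.
Qed.

(** The eigenvectors e_1 + i e_2 and e_1 - i e_2 of e_3 have a product
proportional to e_3, which vanishes in the limit when one of them is scaled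
by t. *)
Lemma degenerates_g4_g3 : degenerates (alg_of g4) (alg_of (g3 (- 1 : K))).
Proof.
have i2 : 'i * 'i = -1 :> K by rewrite -expr2 sqrCi.
apply: degenerates_trans (iso_degenerates iso_g3_N1).
apply: (degenerates_along (c := [:: (0, 1, (0, 0, 2)); (1, 0, (0, 0, - 2))]) (d := [::])
  (u := fun t => (t, t * 'i, 0)) (v := fun t => (1, - 'i, 0)) (w := fun t => (0, 0, - 'i))
  (h := fun t => - 2 * t) (tabP _)) => // t nzt.
- by rewrite mulf_neq0 ?oppr_eq0 ?pnatr_eq0.
- by rewrite /det3 /=; ring: i2.
- by products; ring: i2.
Qed.

(** The basis consists of e_1, t e_3 and their product: e_1 is a cyclic vector
for the action of e_3, even when a = 1. *)
Lemma degenerates_g3_g1 (a : K) : degenerates (alg_of (g3 a)) (alg_of g1).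
Proof.
apply: (degenerates_along (c := [:: (0, 2, (1 + a, 0, 0)); (2, 0, (- (1 + a), 0, 0))]) (d := [:: (0, 2, (0, - a, 0)); (2, 0, (0, a, 0))])
  (u := fun t => (t, t, 0)) (v := fun t => (1, 0, 0)) (w := fun t => (0, 0, t))
  (h := fun t => - t ^+ 2) (alg_prod _)) => // t nzt.
- by rewrite oppr_eq0 expf_neq0.
- by rewrite /det3 /=; ring.
- by products; ring.
Qed.

Lemma degenerates_g3_g2 : degenerates (alg_of (g3 (1 : K))) (alg_of g2).
Proof.
apply: (degenerates_along (c := [:: (0, 2, (0, 1, 0)); (2, 0, (0, - 1, 0))]) (d := [::])
  (u := fun t => (t, 0, 0)) (v := fun t => (0, 1, 0)) (w := fun t => (0, 0, 1))
  (h := fun t => t) (alg_prod _)) => // t nzt.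
- by rewrite /det3 /=; ring.
- by products; ring.
Qed.

Lemma degenerates_C3 (A : structure K) : degenerates A (alg_of C3).
Proof.
apply: (degenerates_curve (C := A) (D := 0)) => t nzt.
exists (t^-1)%:M; first by rewrite unitmxE det_scalar unitfE expf_neq0 ?invr_neq0.
move=> x y; rewrite !mul_scalar_mx /= add0r scaler0 addr0 amulZA amulZl amulZr.
by rewrite !scalerA divff // mul1r.
Qed.

Lemma listed_degenerates (s t : symbol K) :
  listed s t -> degenerates (alg_of s) (alg_of t).
Proof.
case.
- exact: degenerates_L5_L4.
- exact: degenerates_L6_L8.
- exact: degenerates_L7_L6.
- exact: degenerates_L7_L8.
- exact: degenerates_L9_L8.
- exact: degenerates_L9_L6.
- exact: degenerates_L4_L1.
- exact: degenerates_L4_L3.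
- exact: degenerates_L4_g3.
- exact: degenerates_L8_L1.
- exact: degenerates_L6_L1.
- exact: degenerates_L6_L2.
- exact: degenerates_L1_L2.
- exact: degenerates_L1_g1.
- exact: degenerates_L3_L2.
- exact: degenerates_g4_g3.
- exact: degenerates_g3_g1.
- exact: degenerates_g3_g2.
- exact: degenerates_C3.
- exact: degenerates_C3.
- exact: degenerates_C3.
Qed.

End Edges.

(** * Covariants *)

(** A nonassociative monomial in vector variables. *)
Inductive word := Var of nat | Mul of word & word.

(** Scalars attached naturally to a structure, some vectors and some linear
forms: [Pair n w] is the value of the n-th linear form at [w], and [TrL w],
[TrR w], [TrRR w] are the traces of the left multiplication by [w], of the right
multiplication by [w] and of the square of the latter. *)
Inductive covariant (K : Type) :=
  | Const of K
  | Pair of nat & word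
  | TrL of word | TrR of word | TrRR of word
  | Plus of covariant K & covariant K
  | Times of covariant K & covariant K.

Section Covariants.
Variable K : fieldType.
Implicit Types (A B C : structure K) (x y z : 'cV[K]_3) (g : 'M[K]_3).
Implicit Types (r : nat -> 'cV[K]_3) (h : nat -> 'rV[K]_3) (c : covariant K).

Definition lmul A x : 'M[K]_3 := \matrix_(i, j) amul A x (evec K j) i 0.
Definition rmul A x : 'M[K]_3 := \matrix_(i, j) amul A (evec K j) x i 0.

Lemma lmulE A x y : lmul A x *m y = amul A x y.
Proof.
rewrite [in RHS](cV3_sum y) amul_sumr; apply/matrixP => i j; rewrite ord1 summxE mxE.
by apply: eq_bigr => k _; rewrite amulZr !mxE mulrC.
Qed.

Lemma rmulE A x y : rmul A x *m y = amul A y x.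
Proof.
rewrite [in RHS](cV3_sum y) amul_suml; apply/matrixP => i j; rewrite ord1 summxE mxE.
by apply: eq_bigr => k _; rewrite amulZl !mxE mulrC.
Qed.

Lemma mx_ext (M N : 'M[K]_3) : (forall x : 'cV[K]_3, M *m x = N *m x) -> M = N.
Proof.
move=> eqMN; apply/matrixP => i j.
by have /matrixP/(_ i 0) := eqMN (delta_mx j 0); rewrite -!colE !mxE.
Qed.

Lemma lmul_act g A x :
  lmul (gl_act g A) x = g *m lmul A (invmx g *m x) *m invmx g.
Proof. by apply: mx_ext => y; rewrite -!mulmxA !lmulE amul_act. Qed.

Lemma rmul_act g A x :
  rmul (gl_act g A) x = g *m rmul A (invmx g *m x) *m invmx g.
Proof. by apply: mx_ext => y; rewrite -!mulmxA !rmulE amul_act. Qed.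

Lemma mxtrace_conj g (M : 'M[K]_3) : g \in unitmx -> \tr (g *m M *m invmx g) = \tr M.
Proof. by move=> gU; rewrite mxtrace_mulC mulmxA mulVmx // mul1mx. Qed.

Fixpoint eval_word A r w : 'cV[K]_3 :=
  match w with
  | Var n => r n
  | Mul u v => amul A (eval_word A r u) (eval_word A r v)
  end.

Fixpoint eval A r h c : K :=
  match c with
  | Const a => a
  | Pair n w => (h n *m eval_word A r w) 0 0
  | TrL w => \tr (lmul A (eval_word A r w))
  | TrR w => \tr (rmul A (eval_word A r w))
  | TrRR w => \tr (rmul A (eval_word A r w) *m rmul A (eval_word A r w))
  | Plus c d => eval A r h c + eval A r h d
  | Times c d => eval A r h c * eval A r h d
  end.

Definition satisfies A c := forall r h, eval A r h c = 0.

Lemma eval_word_act g A r w : g \in unitmx ->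
  eval_word (gl_act g A) r w = g *m eval_word A (fun n => invmx g *m r n) w.
Proof.
move=> gU; elim: w => [n | u IHu v IHv] /=; first by rewrite mulKVmx.
by rewrite IHu IHv amul_act !mulKmx.
Qed.

(** Naturality: transporting the structure amounts to transporting the vectors
and the linear forms. *)
Lemma eval_act g A r h c : g \in unitmx ->
  eval (gl_act g A) r h c = eval A (fun n => invmx g *m r n) (fun n => h n *m g) c.
Proof.
move=> gU; elim: c => [a | n w | w | w | w | c IHc d IHd | c IHc d IHd] //=.
- by rewrite eval_word_act // mulmxA.
- by rewrite eval_word_act // lmul_act mulKmx // mxtrace_conj.
- by rewrite eval_word_act // rmul_act mulKmx // mxtrace_conj.
- rewrite eval_word_act // rmul_act mulKmx // -[RHS](mxtrace_conj _ gU).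
  by congr (\tr _); rewrite -!mulmxA mulKmx.
- by rewrite IHc IHd.
- by rewrite IHc IHd.
Qed.

Lemma polyfun_eval_word r w k : polyfun (fun A => eval_word A r w k 0).
Proof.
elim: w k => [n | u IHu v IHv] k /=; first exact: polyfun_cst.
under eq_fun do rewrite amulE; apply: polyfun_sum => i.
by apply: polyfunM; [exact: polyfun_entry | exact: polyfunM].
Qed.

Lemma polyfun_lmul r w i j : polyfun (fun A => lmul A (eval_word A r w) i j).
Proof.
under eq_fun do rewrite mxE amulE; apply: polyfun_sum => k.
apply: polyfunM; first exact: polyfun_entry.
by apply: polyfunM; [exact: polyfun_eval_word | exact: polyfun_cst].
Qed.

Lemma polyfun_rmul r w i j : polyfun (fun A => rmul A (eval_word A r w) i j).
Proof.
under eq_fun do rewrite mxE amulE; apply: polyfun_sum => k.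
apply: polyfunM; first exact: polyfun_entry.
by apply: polyfunM; [exact: polyfun_cst | exact: polyfun_eval_word].
Qed.

Lemma polyfun_eval r h c : polyfun (fun A => eval A r h c).
Proof.
elim: c => [a | n w | w | w | w | c IHc d IHd | c IHc d IHd] /=.
- exact: polyfun_cst.
- under eq_fun do rewrite mxE; apply: polyfun_sum => i.
  by apply: polyfunM; [exact: polyfun_cst | exact: polyfun_eval_word].
- by apply: polyfun_sum => i; exact: polyfun_lmul.
- by apply: polyfun_sum => i; exact: polyfun_rmul.
- rewrite /mxtrace; apply: polyfun_sum => i; under eq_fun do rewrite mxE.
  by apply: polyfun_sum => j; apply: polyfunM; exact: polyfun_rmul.
- exact: polyfunD.
- exact: polyfunM.
Qed.

(** An identity is a family of polynomial equations on structures that is stable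
under isomorphism, so it survives in the closure of an orbit. *)
Lemma degenerates_satisfies A B c : degenerates A B -> satisfies A c -> satisfies B c.
Proof.
move=> /degeneratesP AB Ac r h; apply: (AB (fun C => eval C r h c)).
  exact: polyfun_eval.
by move=> g gU; rewrite eval_act.
Qed.

Implicit Types (f : K * K * K -> K * K * K -> K * K * K) (s t : nat -> K * K * K).

Fixpoint word3 f s w :=
  match w with
  | Var n => s n
  | Mul u v => f (word3 f s u) (word3 f s v)
  end.

Definition dot3 (a b : K * K * K) := a.1.1 * b.1.1 + a.1.2 * b.1.2 + a.2 * b.2.

Definition trace3 (F : K * K * K -> K * K * K) :=
  (F (1, 0, 0)).1.1 + (F (0, 1, 0)).1.2 + (F (0, 0, 1)).2.

Fixpoint eval3 f s t c : K :=
  match c with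
  | Const a => a
  | Pair n w => dot3 (t n) (word3 f s w)
  | TrL w => trace3 (f (word3 f s w))
  | TrR w => trace3 (f^~ (word3 f s w))
  | TrRR w => let v := word3 f s w in trace3 (fun u => f (f u v) v)
  | Plus c d => eval3 f s t c + eval3 f s t d
  | Times c d => eval3 f s t c * eval3 f s t d
  end.

Lemma evec_vec (i : 'I_3) :
  evec K i = vec (nth (0, 0, 0) [:: (1, 0, 0); (0, 1, 0); (0, 0, 1)] i).
Proof. by elim/ord3P: i; apply: cV3P; rewrite !mxE. Qed.

Lemma eval_coords A f s t c : computes A f ->
  eval A (fun n => vec (s n)) (fun n => (vec (t n))^T) c = eval3 f s t c.
Proof.
move=> Af.
have wordE w : eval_word A (fun n => vec (s n)) w = vec (word3 f s w).
  by elim: w => [|u IHu v IHv] //=; rewrite IHu IHv Af.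
have traceE (M : 'M[K]_3) F : (forall u, M *m vec u = vec (F u)) -> \tr M = trace3 F.
  move=> MF; have entry i : M i i = (M *m evec K i) i 0 by rewrite -colE mxE.
  by rewrite /mxtrace sum3 !entry !evec_vec !MF !vecE.
elim: c => [a | n w | w | w | w | c IHc d IHd | c IHc d IHd] //=.
- by rewrite wordE mxE sum3 ![_^T _ _]mxE !vecE.
- by rewrite wordE; apply: traceE => x; rewrite lmulE Af.
- by rewrite wordE; apply: traceE => x; rewrite rmulE Af.
- by rewrite wordE; apply: traceE => x; rewrite -mulmxA !rmulE !Af.
- by rewrite IHc IHd.
- by rewrite IHc IHd.
Qed.

(** For a structure with known products in coordinates, an identity is a
polynomial identity in the entries of its variables. *)
Lemma satisfiesP A f c : computes A f ->
  satisfies A c <-> forall s t, eval3 f s t c = 0.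
Proof.
move=> Af; split=> [Ac s t | fc r h]; first by rewrite -(eval_coords _ _ _ Af).
have -> : r = fun n => vec (coords (r n)) by apply/funext => n; rewrite coordsK.
have -> : h = fun n => (vec (coords (h n)^T))^T.
  by apply/funext => n; rewrite coordsK trmxK.
by rewrite (eval_coords _ _ _ Af).
Qed.

End Covariants.

(** * Identities that separate the orbit closures *)

Declare Scope word_scope.
Delimit Scope word_scope with W.
Bind Scope word_scope with word.
Declare Scope covariant_scope.
Delimit Scope covariant_scope with cov.
Bind Scope covariant_scope with covariant.

Arguments Const {K} a%_R.
Arguments Pair {K} n%_N w%_W.
Arguments TrL {K} w%_W.
Arguments TrR {K} w%_W.
Arguments TrRR {K} w%_W.

Section Identities.
Variable K : fieldType.
Implicit Types (a b : K).

Local Notation "u * v" := (Mul u v) : word_scope.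
Local Notation "c + d" := (Plus c d) : covariant_scope.
Local Notation "c * d" := (Times c d) : covariant_scope.
Local Notation "c - d" := (Plus c (Times (Const (- 1)) d)) : covariant_scope.

Local Notation x := (Var 0).
Local Notation y := (Var 1).
Local Notation z := (Var 2).
Local Notation w := (Var 3).
Local Notation phi := (Pair 0).
Local Notation psi := (Pair 1).
Local Notation chi := (Pair 2).

Definition zero_law : covariant K := phi (x * y).
Definition leibniz_law : covariant K :=
  (phi ((x * y) * z) - phi ((x * z) * y) - phi (x * (y * z)))%cov.
Definition anticomm_law : covariant K := (phi (x * y) + phi (y * x))%cov.
Definition comm_law : covariant K := (phi (x * y) - phi (y * x))%cov.
Definition nilpotent_law : covariant K := phi ((x * y) * z).
Definition metabelian_law : covariant K := phi ((x * y) * (z * w)).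

(** The determinant of [x], [y] and [x * y], read through three linear forms. *)
Definition coplanar_law : covariant K :=
  (phi x * (psi y * chi (x * y) - chi y * psi (x * y))
   - psi x * (phi y * chi (x * y) - chi y * phi (x * y))
   + chi x * (phi y * psi (x * y) - psi y * phi (x * y)))%cov.
Definition trR_law : covariant K := TrR x.
Definition trRR_law : covariant K := TrRR x.

(** It holds when right multiplications have eigenvalues proportional to 1, a
and 0: the traces of R and R^2 are then c (1 + a) and c^2 (1 + a^2). *)
Definition spectrum_law a : covariant K :=
  (Const ((1 + a) ^+ 2) * TrRR x - Const (1 + a ^+ 2) * (TrR x * TrR x))%cov.

(** It holds when x y = f(y) T(x) for a linear form f and an operator T, which
means that the right annihilator has codimension at most one. *)
Definition right_law : covariant K :=
  (phi (x * y) * phi (z * w) - phi (x * w) * phi (z * y))%cov.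

(** All products are proportional. *)
Definition rank1_law : covariant K :=
  (phi (x * y) * psi (z * w) - psi (x * y) * phi (z * w))%cov.

(** In L6 with parameter 1, T is the identity minus a projection with kernel ker f,
so that x y - y x = f(y) x - f(x) y, where f is half the trace of R. *)
Definition bracket_law : covariant K :=
  (Const 2 * (phi (x * y) - phi (y * x)) - (TrR y * phi x - TrR x * phi y))%cov.

(** When the products lie on a line, they are given by a bilinear form; the law
compares its determinant with the square of its alternating part.  Their ratio
is the invariant of the form under congruence and scaling. *)
Definition pencil_law b : covariant K :=
  (phi (x * x) * phi (y * y) - phi (x * y) * phi (y * x)
   - Const b * ((phi (x * y) - phi (y * x)) * (phi (x * y) - phi (y * x))))%cov.

(** The next five laws hold in L4 with parameter a, where right multiplication
by x has the eigenvalues a l(x), l(x) and 0, for the linear form l opposite to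
the trace of L. *)
Definition L4_trace_law a : covariant K := (TrR x + Const (1 + a) * TrL x)%cov.
Definition L4_square_law a : covariant K :=
  (TrRR x - Const (1 + a ^+ 2) * (TrL x * TrL x))%cov.
Definition L4_cube_law a : covariant K :=
  (phi ((x * x) * x) + Const a * (TrL x * phi (x * x)))%cov.

(** The squares of the elements of the kernel of l vanish; l(y) x - l(x) y is a
generic such element. *)
Definition L4_kernel_law : covariant K :=
  (TrL y * TrL y * phi (x * x) - TrL x * TrL y * (phi (x * y) + phi (y * x))
   + TrL x * TrL x * phi (y * y))%cov.

(** Let J be the kernel of l, which contains all products and satisfies J J = 0.
On J, R_z - (a - 1) L_z is the scalar a l(z).  In a limit where l = 0 and the
products lie on a line, the bilinear form f of the products thus has an isotropic
vector p with f(p, z) = (a - 1) f(z, p), which is the relation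
(2 - a)^2 det f = (1 - a) alt(f)^2.  The last term of the law corrects this
relation when l is not 0: in L4 the difference of its sides is a multiple of the
element l(y) x - l(x) y of J. *)
Definition L4_pencil_law a : covariant K :=
  (Const ((2 - a) ^+ 2) * (phi (x * x) * phi (y * y) - phi (x * y) * phi (y * x))
   - Const (1 - a) * ((phi (x * y) - phi (y * x)) * (phi (x * y) - phi (y * x)))
   - Const (a ^+ 2) * ((phi (x * y) - phi (y * x) - (TrL x * phi y - TrL y * phi x))
                        * (TrL x * phi y - TrL y * phi x)))%cov.

End Identities.

(* Evaluates a law on a listed algebra at generic vectors and linear forms. *)
Ltac identity :=
  let s := fresh "s" in let t := fresh "t" in
  apply/(satisfiesP _ (alg_prod _)) => s t; rewrite /= /trace3 /dot3 /=;
  case: (s 0%N) => [[? ?] ?]; case: (s 1%N) => [[? ?] ?];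
  case: (s 2%N) => [[? ?] ?]; case: (s 3%N) => [[? ?] ?];
  case: (t 0%N) => [[? ?] ?]; case: (t 1%N) => [[? ?] ?]; case: (t 2%N) => [[? ?] ?] /=;
  ring.

Section Source.
Variable K : fieldType.
Implicit Types (a b : K).

Lemma leibniz_alg (s : symbol K) : satisfies (alg_of s) (leibniz_law K).
Proof. by case: s => [|||a||b|||a||a|||]; identity. Qed.

Lemma zero_C3 : satisfies (alg_of C3) (zero_law K). Proof. by identity. Qed.
Lemma anti_g1 : satisfies (alg_of g1) (anticomm_law K). Proof. by identity. Qed.
Lemma anti_g2 : satisfies (alg_of g2) (anticomm_law K). Proof. by identity. Qed.
Lemma anti_g3 a : satisfies (alg_of (g3 a)) (anticomm_law K). Proof. by identity. Qed.
Lemma anti_g4 : satisfies (alg_of g4) (anticomm_law K). Proof. by identity. Qed.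
Lemma nil_g1 : satisfies (alg_of g1) (nilpotent_law K). Proof. by identity. Qed.
Lemma span_g2 : satisfies (alg_of g2) (coplanar_law K). Proof. by identity. Qed.
Lemma solv_g3 a : satisfies (alg_of (g3 a)) (metabelian_law K). Proof. by identity. Qed.
Lemma spec_g3 a : satisfies (alg_of (g3 a)) (spectrum_law a). Proof. by identity. Qed.
Lemma trR_g4 : satisfies (alg_of g4) (trR_law K). Proof. by identity. Qed.
Lemma nil_L1 b : satisfies (alg_of (L1 b)) (nilpotent_law K). Proof. by identity. Qed.
Lemma pencil_L1 b : satisfies (alg_of (L1 b)) (pencil_law b). Proof. by identity. Qed.
Lemma comm_L2 : satisfies (alg_of L2) (comm_law K). Proof. by identity. Qed.
Lemma pencil_L2 : satisfies (alg_of L2) (pencil_law (0 : K)). Proof. by identity. Qed.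
Lemma comm_L3 : satisfies (alg_of L3) (comm_law K). Proof. by identity. Qed.
Lemma trace_L4 a : satisfies (alg_of (L4 a)) (L4_trace_law a). Proof. by identity. Qed.
Lemma trace2_L4 a : satisfies (alg_of (L4 a)) (L4_square_law a). Proof. by identity. Qed.
Lemma cube_L4 a : satisfies (alg_of (L4 a)) (L4_cube_law a). Proof. by identity. Qed.
Lemma kernel_L4 a : satisfies (alg_of (L4 a)) (L4_kernel_law K). Proof. by identity. Qed.
Lemma bracket_pencil_L4 a : satisfies (alg_of (L4 a)) (L4_pencil_law a).
Proof. by identity. Qed.
Lemma trace_L5 : satisfies (alg_of L5) (L4_trace_law (2 : K)). Proof. by identity. Qed.
Lemma trace2_L5 : satisfies (alg_of L5) (L4_square_law (2 : K)). Proof. by identity. Qed.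
Lemma cube_L5 : satisfies (alg_of L5) (L4_cube_law (2 : K)). Proof. by identity. Qed.
Lemma bracket_pencil_L5 : satisfies (alg_of L5) (L4_pencil_law (2 : K)).
Proof. by identity. Qed.
Lemma right_L6 a : satisfies (alg_of (L6 a)) (right_law K). Proof. by identity. Qed.
Lemma spec_L6 a : satisfies (alg_of (L6 a)) (spectrum_law a). Proof. by identity. Qed.
Lemma rank1_L6 : satisfies (alg_of (L6 0)) (rank1_law K). Proof. by identity. Qed.
Lemma bracket_L6 : satisfies (alg_of (L6 1)) (bracket_law K). Proof. by identity. Qed.
Lemma right_L7 : satisfies (alg_of L7) (right_law K). Proof. by identity. Qed.
Lemma spec_L7 : satisfies (alg_of L7) (spectrum_law (1 : K)). Proof. by identity. Qed.
Lemma right_L8 : satisfies (alg_of L8) (right_law K). Proof. by identity. Qed.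
Lemma trR_L8 : satisfies (alg_of L8) (trR_law K). Proof. by identity. Qed.
Lemma trRR_L8 : satisfies (alg_of L8) (trRR_law K). Proof. by identity. Qed.
Lemma right_L9 : satisfies (alg_of L9) (right_law K). Proof. by identity. Qed.
Lemma spec_L9 : satisfies (alg_of L9) (spectrum_law (0 : K)). Proof. by identity. Qed.

Lemma leibnizP (A : structure K) : leibniz A <-> satisfies A (leibniz_law K).
Proof.
split=> [LA r h | LA u v t] /=.
  by rewrite LA !mulmxDr !mxE; ring.
apply/eqP; rewrite -subr_eq0; apply/eqP/matrixP => i j; rewrite ord1 [RHS]mxE.
pose r (n : nat) := nth 0 [:: u; v; t] n.
have entry (v' : 'cV[K]_3) : ((delta_mx 0 i : 'rV[K]_3) *m v') 0 0 = v' i 0 by rewrite -rowE mxE.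
have := LA r (fun=> delta_mx 0 i); rewrite /= !entry => LAi.
by rewrite -[RHS]LAi mxE [X in _ + X]mxE [X in - X]mxE; ring.
Qed.
End Source.

(* Adds the equation [v = 0] obtained by evaluating the law [H] at the vectors
   [vs] and the linear forms [fs]. *)
Ltac value E H vs fs v :=
  have E : v = 0; [
    rewrite -[RHS](proj1 (satisfiesP _ (alg_prod _)) H (nth (0, 0, 0) vs) (nth (0, 0, 0) fs))
      /= /trace3 /dot3 /=; ring |].

Section Target.
Variable K : numFieldType.
Implicit Types (a b : K) (t : symbol K).

Local Notation E1 := ((1, 0, 0) : K * K * K).
Local Notation E2 := ((0, 1, 0) : K * K * K).
Local Notation E3 := ((0, 0, 1) : K * K * K).

Let one0 (P : Prop) : 1 = 0 :> K -> P.
Proof. by move/eqP; rewrite oner_eq0. Qed.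
Let two0 (P : Prop) : 2 = 0 :> K -> P.
Proof. by move/eqP; rewrite pnatr_eq0. Qed.

(* The same, when the value of the law is 1 or 2. *)
Ltac refute H vs fs :=
  solve [ let E := fresh "E" in value E H vs fs (1 : K); exact: one0 E
        | let E := fresh "E" in value E H vs fs (2 : K); exact: two0 E ].

(** Each of the following lemmas selects the listed algebras that can satisfy a
given law, by evaluating the law at well-chosen basis vectors. *)
Lemma zero_target t : satisfies (alg_of t) (zero_law K) -> t = C3.
Proof.
case: t => [|||a||b|||a||a|||] H //;
  first [ refute H [:: E3; E3] [:: E1] | refute H [:: E2; E3] [:: E1]
        | refute H [:: E2; E3] [:: E2] | refute H [:: E1; E3] [:: E1]].
Qed.

Definition is_lie t :=
  match t with C3 | g1 | g2 | g3 _ | g4 => True | _ => False end.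

Lemma anti_target t : satisfies (alg_of t) (anticomm_law K) -> is_lie t.
Proof.
case: t => [|||a||b|||a||a|||] H //;
  first [ refute H [:: E3; E3] [:: E1] | refute H [:: E2; E3] [:: E2] ].
Qed.

Definition is_commutative t := match t with C3 | L2 | L3 => True | _ => False end.

Lemma comm_target t : satisfies (alg_of t) (comm_law K) -> is_commutative t.
Proof.
case: t => [|||a||b|||a||a|||] H //;
  first [ refute H [:: E2; E3] [:: E1] | refute H [:: E2; E3] [:: E2]
        | refute H [:: E1; E3] [:: E1] | refute H [:: E3; E2] [:: E1]
        | refute H [:: E1; E3] [:: E2] ].
Qed.

Definition is_2nilpotent t :=
  match t with C3 | g1 | L1 _ | L2 | L3 => True | _ => False end.

Lemma nil_target t : satisfies (alg_of t) (nilpotent_law K) -> is_2nilpotent t.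
Proof.
case: t => [|||a||b|||a||a|||] H //;
  first [ refute H [:: E2; E3; E3] [:: E2] | refute H [:: E1; E3; E3] [:: E1]
        | refute H [:: E1; E2; E1] [:: E2] | refute H [:: E3; E3; E3] [:: E2] ].
Qed.

Lemma span_target t : is_lie t -> satisfies (alg_of t) (coplanar_law K) ->
  match t with C3 | g2 => True | _ => False end.
Proof.
case: t => [|||a||b|||a||a|||] _ H //;
  first [ refute H [:: E2; E3] [:: E1; E2; E3] | refute H [:: E3; E1] [:: E2; E1; E3] ].
Qed.

Lemma solv_target t : satisfies (alg_of t) (metabelian_law K) ->
  match t with g4 => False | _ => True end.
Proof. by case: t => // H; refute H [:: E1; E2; E2; E3] [:: E2]. Qed.

Lemma spec_target a t : satisfies (alg_of t) (spectrum_law a) ->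
  match t with
  | g2 | L7 => a = 1
  | g3 b | L6 b => a = b \/ a * b = 1
  | L9 => a = 0
  | _ => True
  end.
Proof.
have split b : 2 * ((a - b) * (1 - a * b)) = 0 -> a = b \/ a * b = 1.
  move/eqP; rewrite !mulf_eq0 pnatr_eq0 /= => /orP[]; rewrite subr_eq0 => /eqP; by [left|right].
have unit : 2 * ((a - 1) * (1 - a * 1)) = 0 -> a = 1.
  by move/split; rewrite mulr1 => -[].
case: t => [|||b||b|||b||b|||] H //.
- value E H [:: E3] [:: E1] (2 * ((a - 1) * (1 - a * 1))); exact: unit.
- value E H [:: E3] [:: E1] (2 * ((a - b) * (1 - a * b))); exact: split.
- value E H [:: E3] [:: E1] (2 * ((a - b) * (1 - a * b))); exact: split.
- value E H [:: E3] [:: E1] (2 * ((a - 1) * (1 - a * 1))); exact: unit.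
- value E H [:: E3] [:: E1] (2 * a).
  by move/eqP: E; rewrite mulf_eq0 pnatr_eq0 => /eqP.
Qed.

Lemma trR_target t : satisfies (alg_of t) (trR_law K) ->
  match t with
  | g2 | L7 | L9 => False
  | g3 b | L6 b => b = -1
  | _ => True
  end.
Proof.
case: t => [|||b||b|||b||b|||] H //; try by refute H [:: E3] [:: E1].
all: value E H [:: E3] [:: E1] (b + 1).
all: by apply/eqP; rewrite -addr_eq0 E.
Qed.

Lemma trRR_target t : satisfies (alg_of t) (trRR_law K) ->
  match t with L6 b => b != -1 | _ => True end.
Proof.
case: t => // b H; apply/eqP => bN1; rewrite bN1 in H; refute H [:: E3] [:: E1].
Qed.

Lemma right_target t : satisfies (alg_of t) (right_law K) ->
  match t with
  | g1 | g2 | g3 _ | g4 | L3 | L4 _ | L5 => False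
  | L1 b => b = 0
  | _ => True
  end.
Proof.
case: t => [|||a||b|||a||a|||] H //.
- refute H [:: E2; E2; E3; E3] [:: E1].
- refute H [:: E2; E2; E3; E3] [:: E2].
- refute H [:: E1; E1; E3; E3] [:: E1].
- refute H [:: E2; E2; E3; E3] [:: E1].
- value E H [:: E2; E2; E3; E3] [:: E1] b; exact: E.
- refute H [:: E2; E2; E3; E3] [:: E1].
- refute H [:: E2; E2; E3; E3] [:: E2].
- refute H [:: E2; E2; E3; E3] [:: E2].
Qed.

Lemma rank1_target t : satisfies (alg_of t) (rank1_law K) ->
  match t with L7 | L8 | L9 => False | _ => True end.
Proof.
case: t => // H; first [ refute H [:: E3; E3; E1; E3] [:: E1; E2]
                       | refute H [:: E1; E3; E2; E3] [:: E1; E2] ].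
Qed.

Lemma bracket_target t : satisfies (alg_of t) (bracket_law K) ->
  match t with L1 _ | L7 | L8 | L9 => False | _ => True end.
Proof.
case: t => // [b|||] H; first [ refute H [:: E3; E2] [:: E1] | refute H [:: E1; E3] [:: E2] ].
Qed.

Lemma pencil_target b t : satisfies (alg_of t) (pencil_law b) ->
  match t with
  | g1 => b = 4^-1
  | L1 c => c = b
  | L3 => False
  | _ => True
  end.
Proof.
case: t => // [|c|] H.
- value E H [:: E2; E3] [:: E1] (1 - 4 * b).
  apply: (mulfI (x := 4)); first by rewrite pnatr_eq0.
  by rewrite divff ?pnatr_eq0 //; apply/eqP; rewrite eq_sym -subr_eq0 E.
- value E H [:: E2; E3] [:: E1] (c - b).
  by apply/eqP; rewrite -subr_eq0 E.
- refute H [:: E2; E3] [:: E1].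
Qed.

(** The first two laws compare the spectra of the multiplications and the third
one excludes L8; the last one handles g1, L1 and L3, on which all the traces
vanish. *)
Lemma L4_target a t :
  satisfies (alg_of t) (L4_trace_law a) -> satisfies (alg_of t) (L4_square_law a) ->
  satisfies (alg_of t) (L4_cube_law a) -> satisfies (alg_of t) (L4_pencil_law a) ->
  match t with
  | C3 | L2 => True
  | g1 => a = 0
  | g3 b => a = 0 /\ b = 0
  | L1 b => (2 - a) ^+ 2 * b = 1 - a
  | L3 | L5 => a = 2
  | L4 b => a = b
  | _ => False
  end.
Proof.
case: t => [|||b||b|||b||b|||] // tr tr2 cb bp.
- value E bp [:: E2; E3] [:: E1] (a ^+ 2).
  by apply/eqP; rewrite -sqrf_eq0 E.
- value E tr [:: E3] [:: E1] (- 2 * a).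
  have a0 : a = 0 by move/eqP: E; rewrite mulf_eq0 oppr_eq0 pnatr_eq0 => /eqP.
  rewrite a0 in tr2; value F tr2 [:: E3] [:: E1] (- 2 : K).
  by move/eqP: F; rewrite oppr_eq0 => /eqP; exact: two0.
- value E tr [:: E3] [:: E1] (- a * (1 + b)).
  value E' tr2 [:: E3] [:: E1] (1 + b ^+ 2 - (1 + a ^+ 2) * (1 + b) ^+ 2).
  move/eqP: E; rewrite mulf_eq0 oppr_eq0 => /orP[/eqP a0|].
    split=> //; have : 2 * b = 0 by rewrite -(oppr0) -E' a0; ring.
    by move/eqP; rewrite mulf_eq0 pnatr_eq0 => /eqP.
  rewrite addrC addr_eq0 => /eqP bN1; apply: two0; rewrite -E' bN1; ring.
- value E tr2 [:: E3] [:: E1] (- 2 : K).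
  by move/eqP: E; rewrite oppr_eq0 => /eqP; exact: two0.
- value E bp [:: E2; E3] [:: E1] ((2 - a) ^+ 2 * b - (1 - a)).
  by apply/eqP; rewrite -subr_eq0 E.
- value E bp [:: E2; E3] [:: E1] ((2 - a) ^+ 2).
  by apply/eqP; rewrite eq_sym -subr_eq0 -sqrf_eq0 E.
- value E tr [:: E3] [:: E1] (b - a).
  by apply/eqP; rewrite eq_sym -subr_eq0 E.
- value E tr [:: E3] [:: E1] (2 - a).
  by apply/eqP; rewrite eq_sym -subr_eq0 E.
- value E tr [:: E3] [:: E1] (b + 1).
  have bN1 : b = -1 by apply/eqP; rewrite -addr_eq0 E.
  by rewrite bN1 in tr2; refute tr2 [:: E3] [:: E1].
- refute tr [:: E3] [:: E1].
- refute cb [:: E3] [:: E2].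
- refute tr [:: E3] [:: E1].
Qed.

Lemma kernel_target t : satisfies (alg_of t) (L4_kernel_law K) ->
  match t with L5 => False | _ => True end.
Proof. by case: t => // H; refute H [:: E2; E3] [:: E1]. Qed.

(** Existence of a path of listed edges, possibly of length zero, in terms of the
parameters. *)
Definition reach (s t : symbol K) : Prop :=
  match s, t with
  | _, C3 => True
  | g1, g1 | g2, g2 | g4, (g4 | g1) | L2, L2 | L3, (L3 | L2)
  | g3 _, g1 | L1 _, L2 | L4 _, L2 | L5, (L5 | L3 | L2)
  | L6 _, L2 | L7, (L7 | L8 | L2) | L8, (L8 | L2) | L9, (L9 | L8 | L2) => True
  | g3 a, g2 => a = 1
  | g3 a, g3 b | L6 a, L6 b => a = b \/ a * b = 1
  | g4, g3 b => b = -1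
  | L1 a, g1 => a = 4^-1
  | L1 a, L1 b => b = a
  | L4 a, g1 => a = 0
  | L4 a, g3 b => a = 0 /\ b = 0
  | L4 a, L1 b => (2 - a) ^+ 2 * b = 1 - a
  | L4 a, L3 => a = 2
  | L4 a, L4 b => a = b
  | L5, L4 a => a = 2
  | L6 a, L8 => a <> 0 /\ a <> 1
  | L6 a, L1 b => a <> 1 /\ b = 0
  | L7, L6 a => a = 1
  | (L7 | L8 | L9), L1 b => b = 0
  | L9, L6 a => a = 0
  | _, _ => False
  end.

(** Every pair of vertices absent from the table is separated by one of the laws
of the source. *)
Lemma degenerates_reach (s t : symbol K) :
  degenerates (alg_of s) (alg_of t) -> reach s t.
Proof.
move=> D; have tr c : satisfies (alg_of s) c -> satisfies (alg_of t) c.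
  exact: degenerates_satisfies.
case: s D tr => [|||a||a|||a||a|||] D tr.
- by have -> := zero_target (tr _ (@zero_C3 K)).
- have := anti_target (tr _ (@anti_g1 K)).
  by have := nil_target (tr _ (@nil_g1 K)); case: t {D tr}.
- have lie := anti_target (tr _ (@anti_g2 K)).
  by have := span_target lie (tr _ (@span_g2 K)); case: t {D tr lie}.
- have := anti_target (tr _ (anti_g3 a)).
  have := solv_target (tr _ (solv_g3 a)).
  by have := spec_target (tr _ (spec_g3 a)); case: t {D tr}.
- have := anti_target (tr _ (@anti_g4 K)).
  by have := trR_target (tr _ (@trR_g4 K)); case: t {D tr}.
- have := nil_target (tr _ (nil_L1 a)).
  by have := pencil_target (tr _ (pencil_L1 a)); case: t {D tr}.
- have := comm_target (tr _ (@comm_L2 K)).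
  by have := pencil_target (tr _ (@pencil_L2 K)); case: t {D tr}.
- by have := comm_target (tr _ (@comm_L3 K)); case: t {D tr}.
- have := L4_target (tr _ (trace_L4 a)) (tr _ (trace2_L4 a)) (tr _ (cube_L4 a))
    (tr _ (bracket_pencil_L4 a)).
  by have := kernel_target (tr _ (kernel_L4 a)); case: t {D tr}.
- have := L4_target (tr _ (@trace_L5 K)) (tr _ (@trace2_L5 K)) (tr _ (@cube_L5 K))
    (tr _ (@bracket_pencil_L5 K)).
  case: t {D tr} => //= [|b []|b]; try exact: two0.
  by rewrite subrr expr0n mul0r => E; apply: one0; rewrite -[RHS]oppr0 E; ring.
- have := right_target (tr _ (right_L6 a)); have := spec_target (tr _ (spec_L6 a)).
  have br : a = 1 -> match t with L1 _ | L7 | L8 | L9 => False | _ => True end.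
    by move=> a1; apply/bracket_target/tr; rewrite a1; exact: bracket_L6.
  have r1 : a = 0 -> match t with L7 | L8 | L9 => False | _ => True end.
    by move=> a0; apply/rank1_target/tr; rewrite a0; exact: rank1_L6.
  by case: t br r1 {D tr} => //= b br _ _ ->; split.
- have := right_target (tr _ (@right_L7 K)); have := spec_target (tr _ (@spec_L7 K)).
  case: t {D tr} => //= [b [<-|]|]; rewrite ?mul1r //; exact: one0.
- have := right_target (tr _ (@right_L8 K)); have := trR_target (tr _ (@trR_L8 K)).
  have := trRR_target (tr _ (@trRR_L8 K)).
  by case: t {D tr} => //= b /eqP.
- have := right_target (tr _ (@right_L9 K)); have := spec_target (tr _ (@spec_L9 K)).
  case: t {D tr} => //= [b [<- //|]|/esym]; last exact: one0.
  by rewrite mul0r => /esym; exact: one0.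
Qed.
End Target.

(** * Normal forms *)

Section NormalForms.
Variable K : numClosedFieldType.
Implicit Types (a b c l m n p q r : K).

Definition classified (A : structure K) := exists s, isomorphic A (alg_of s).

Lemma classified_iso A B : isomorphic A B -> classified B -> classified A.
Proof. by move=> AB [s Bs]; exists s; exact: iso_trans AB Bs. Qed.

Lemma classified_comb (A : structure K) f (s : symbol K) u v w d :
  computes A f -> det3 u v w = d -> d != 0 ->
  (forall x y, f (comb u v w x) (comb u v w y) = comb u v w (prod_of s x y)) ->
  classified A.
Proof.
move=> Af detE nzd fs; exists s.
by apply: (iso_comb (u := u) (v := v) (w := w) Af (alg_prod s)); rewrite ?detE.
Qed.

Lemma quadratic_roots (b c : K) : exists l m, l + m = b /\ l * m = c.
Proof.
pose d := sqrtC (b ^+ 2 - 4 * c).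
have d2 : d * d = b ^+ 2 - 4 * c by rewrite -expr2 sqrtCK.
exists ((b + d) / 2), ((b - d) / 2); split; first by field.
have -> : (b + d) / 2 * ((b - d) / 2) = (b ^+ 2 - d * d) / 4 by field.
by rewrite d2; field.
Qed.

(** In [diag_form], [triangular_form] and [right_form], e_1 and e_2 belong to the
right annihilator, and e_3 acts on the right on their span by a diagonal, a
triangular or an arbitrary operator. *)
Definition diag_form l m p q :=
  tab [:: (0, 2, (l, 0, 0)); (1, 2, (0, m, 0)); (2, 2, (p, q, 0))].

Lemma diag_form_swap l m p q : isomorphic (diag_form l m p q) (diag_form m l q p).
Proof.
apply: (iso_comb (u := (0, 1, 0)) (v := (1, 0, 0)) (w := (0, 0, 1)) (tabP _) (tabP _)) => //.
  have -> : det3 (0, 1, 0) (1, 0, 0) (0, 0, 1) = - 1 :> K by rewrite /det3 /=; ring.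
  by rewrite oppr_eq0 oner_eq0.
by products; ring.
Qed.

Lemma diag_form_classified l m p q : classified (diag_form l m p q).
Proof.
(* exchanging e_1 and e_2, m vanishes only if l does, and then q only if p does *)
wlog nzm : l m p q / m = 0 -> l = 0 /\ (q = 0 -> p = 0).
  move=> hyp; have [m0|nzm] := eqVneq m 0; last by apply: hyp => m0; rewrite m0 eqxx in nzm.
  have [l0|nzl] := eqVneq l 0; last first.
    apply: classified_iso (diag_form_swap l m p q) _; apply: hyp => l0.
    by rewrite l0 eqxx in nzl.
  have [q0|nzq] := eqVneq q 0.
    apply: classified_iso (diag_form_swap l m p q) _; apply: hyp => _; split=> // _.
  by apply: hyp => _; split=> // q0; rewrite q0 eqxx in nzq.
have [m0|{}nzm] := eqVneq m 0.
  have [-> pq] := nzm m0; rewrite m0 {nzm m0}.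
  have [q0|nzq] := eqVneq q 0.
    rewrite q0 pq //; apply: (classified_comb (s := C3) (u := (1, 0, 0)) (v := (0, 1, 0))
      (w := (0, 0, 1)) (d := 1) (tabP _)); rewrite ?oner_eq0 //.
      by rewrite /det3 /=; ring.
    by products; ring.
  apply: (classified_comb (s := L2) (u := (p, q, 0)) (v := (1, 0, 0)) (w := (0, 0, 1)) (d := - q)
     (tabP _)); rewrite ?oppr_eq0 //; first by rewrite /det3 /=; ring.
  by products; ring.
have [l0|nzl] := eqVneq l 0.
  have [p0|nzp] := eqVneq p 0.
    apply: (classified_comb (s := L6 0) (u := (1, 0, 0)) (v := (0, 1, 0))
      (w := (0, - q / m / m, m^-1)) (d := m^-1) (tabP _)); rewrite ?invr_eq0 //.
      by rewrite /det3 /=; ring.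
    by products; rewrite ?l0 ?p0; field.
  apply: (classified_comb (s := L9) (u := (p / m ^+ 2, 1, 0)) (v := (0, 1, 0))
      (w := (0, (m ^+ 2 - q) / m / m, m^-1)) (d := p / m ^+ 3) (tabP _)) => //.
  - by rewrite /det3 /=; field.
  - by rewrite mulf_neq0 ?invr_neq0 ?expf_neq0.
  - by products; rewrite ?l0; field.
apply: (classified_comb (s := L6 (l / m)) (u := (1, 0, 0)) (v := (0, 1, 0))
      (w := (- p / l / m, - q / m / m, m^-1)) (d := m^-1) (tabP _)); rewrite ?invr_eq0 //.
  by rewrite /det3 /=; ring.
by products; field; rewrite ?nzl ?nzm.
Qed.

Definition triangular_form l m n p q :=
  tab [:: (0, 2, (l, 0, 0)); (1, 2, (n, m, 0)); (2, 2, (p, q, 0))].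

(** Distinct eigenvalues can be diagonalized; otherwise the operator is a Jordan
block, and e_3 e_3 can be removed by a change of e_3 whenever it lies in the image
of the block. *)
Lemma triangular_form_classified l m n p q : classified (triangular_form l m n p q).
Proof.
have [->|nzn] := eqVneq n 0; first exact: diag_form_classified.
have [lm|lm] := eqVneq l m; last first.
  have nz : m - l != 0 by rewrite subr_eq0 eq_sym.
  apply: classified_iso (diag_form_classified l m (p - q * (n / (m - l))) q).
  apply: (iso_comb (u := (1, 0, 0)) (v := (n / (m - l), 1, 0)) (w := (0, 0, 1)) (tabP _) (tabP _)) => //.
    have -> : det3 (1, 0, 0) (n / (m - l), 1, 0) (0, 0, 1) = 1 by rewrite /det3 /=; ring.
    by rewrite oner_eq0.
  by products; field.
rewrite lm; have [m0|nzm] := eqVneq m 0.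
  have [q0|nzq] := eqVneq q 0.
    apply: (classified_comb (s := L1 0) (u := (n, 0, 0)) (v := (0, - p / n, 1))
      (w := (0, 1 - p / n, 1)) (d := - n) (tabP _)); rewrite ?oppr_eq0 //.
      by rewrite /det3 /=; field.
    by products; rewrite ?m0 ?q0; field.
  apply: (classified_comb (s := L8) (u := (p, q, 0)) (v := (q * n, 0, 0))
      (w := (0, 0, 1)) (d := - (q ^+ 2 * n)) (tabP _)) => //.
  - by rewrite /det3 /=; ring.
  - by rewrite oppr_eq0 mulf_neq0 ?expf_neq0.
  - by products; rewrite ?m0; ring.
apply: (classified_comb (s := L7) (u := (0, 1, 0)) (v := (n / m, 0, 0))
      (w := ((q * n / m - p) / m ^+ 2, - q / m ^+ 2, m^-1)) (d := - n / m ^+ 2) (tabP _)) => //.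
- by rewrite /det3 /=; field.
- by rewrite mulf_neq0 ?oppr_eq0 ?invr_neq0 ?expf_neq0.
- by products; field.
Qed.

Definition right_form m11 m21 m12 m22 :=
  tab [:: (0, 2, (m11, m21, 0)); (1, 2, (m12, m22, 0)); (2, 2, (1, 0, 0))] : structure K.

(** If T is the action of e_3, with eigenvalues l and m, then T(e_1) - m e_1 is an
eigenvector for l by the theorem of Cayley and Hamilton. *)
Lemma right_form_classified m11 m21 m12 m22 : classified (right_form m11 m21 m12 m22).
Proof.
have [->|nz21] := eqVneq m21 0; first exact: triangular_form_classified.
have [l [m [tr dt]]] := quadratic_roots (m11 + m22) (m11 * m22 - m12 * m21).
apply: classified_iso (triangular_form_classified l m 1 0 1).
have E22 : m22 = l + m - m11 by rewrite tr; ring.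
have E12 : m12 = (m11 * m22 - l * m) / m21 by rewrite dt; field.
apply: (iso_comb (u := (m11 - m, m21, 0)) (v := (1, 0, 0)) (w := (0, 0, 1)) (tabP _) (tabP _)) => //.
  have -> : det3 (m11 - m, m21, 0) (1, 0, 0) (0, 0, 1) = - m21 by rewrite /det3 /=; ring.
  by rewrite oppr_eq0.
by products; rewrite ?E12 ?E22; field.
Qed.

(** The products are the values of a bilinear form with matrix [k r; r' 1] on the
span of e_2 and e_3. *)
Definition bilinear_form k r r' :=
  tab [:: (1, 1, (k, 0, 0)); (1, 2, (r, 0, 0)); (2, 1, (r', 0, 0)); (2, 2, (1, 0, 0))]
  : structure K.

Lemma bilinear_form_classified k r r' : classified (bilinear_form k r r').
Proof.
have [->|rr'] := eqVneq r' r; last first.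
  have nz : r' - r != 0 by rewrite subr_eq0.
  apply: (classified_comb (s := L1 ((k - r * r') / (r' - r) ^+ 2)) (u := (1, 0, 0))
    (v := (0, (r' - r)^-1, - r / (r' - r))) (w := (0, 0, 1)) (d := (r' - r)^-1) (tabP _)) => //.
  - by rewrite /det3 /=; ring.
  - by rewrite invr_eq0.
  - by products; field.
have [k0|nzk] := eqVneq (k - r ^+ 2) 0.
  have -> : k = r ^+ 2 by apply/eqP; rewrite -subr_eq0 k0.
  apply: (classified_comb (s := L2) (u := (1, 0, 0))
    (v := (0, 1, - r)) (w := (0, 0, 1)) (d := 1) (tabP _)); rewrite ?oner_eq0 //.
  - by rewrite /det3 /=; ring.
  - by products; ring.
pose h := sqrtC (k - r ^+ 2).
have h2 : k = h ^+ 2 + r ^+ 2 by rewrite sqrtCK subrK.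
have nzh : h != 0 by rewrite sqrtC_eq0.
apply: (classified_comb (s := L3) (u := (1, 0, 0))
    (v := (0, h^-1, - r / h)) (w := (0, 0, 1)) (d := h^-1) (tabP _)); rewrite ?invr_eq0 //.
- by rewrite /det3 /=; ring.
- by products; rewrite ?h2; field.
Qed.

(** The quotient by the line of e_1 is the nonabelian Lie algebra of dimension
two. *)
Definition nonabelian_form a k m :=
  tab [:: (0, 2, (a, 0, 0)); (1, 1, (k, 0, 0)); (1, 2, (0, 1, 0)); (2, 1, (0, - 1, 0));
          (2, 2, (m, 0, 0))] : structure K.

Lemma nonabelian_form_classified a k m : k * (a - 2) = 0 -> classified (nonabelian_form a k m).
Proof.
have [-> _|nzk] := eqVneq k 0; last first.
  move/eqP; rewrite mulf_eq0 (negPf nzk) subr_eq0 /= => /eqP ->.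
  apply: (classified_comb (s := L5) (u := (k, 0, 0))
    (v := (0, 1, 0)) (w := ((k - m) / 2, 0, 1)) (d := k) (tabP _)) => //.
  - by rewrite /det3 /=; ring.
  - by products; field.
have [->|nza] := eqVneq a 0; last first.
  apply: (classified_comb (s := L4 a) (u := (1, 0, 0))
    (v := (0, 1, 0)) (w := ((1 - m) / a, 0, 1)) (d := 1) (tabP _)); rewrite ?oner_eq0 //.
  - by rewrite /det3 /=; ring.
  - by products; field.
have [->|nzm] := eqVneq m 0; last first.
  apply: (classified_comb (s := L4 0) (u := (m, 0, 0))
    (v := (0, 1, 0)) (w := (0, 0, 1)) (d := m) (tabP _)) => //.
  - by rewrite /det3 /=; ring.
  - by products; ring.
apply: (classified_comb (s := g3 0) (u := (1, 1, 0))
    (v := (- 1, 0, 0)) (w := (0, 0, 1)) (d := 1) (tabP _)); rewrite ?oner_eq0 //.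
- by rewrite /det3 /=; ring.
- by products; ring.
Qed.

(** Here e_3 = e_1 e_2 and e_1 e_3 = 0, so that e_2 acts on the abelian ideal
spanned by e_1 and e_3 by a companion matrix. *)
Definition solvable_form p r :=
  tab [:: (0, 1, (0, 0, 1)); (1, 0, (0, 0, - 1)); (1, 2, (p, 0, r)); (2, 1, (- p, 0, - r))]
  : structure K.

Lemma solvable_form_classified p r : classified (solvable_form p r).
Proof.
have [l [m [lm p_lm]]] := quadratic_roots (- r) p.
wlog nzl : l m lm p_lm / l = 0 -> m = 0.
  move=> hyp; have [l0|nzl] := eqVneq l 0.
    by apply: (hyp m l); rewrite 1?addrC 1?mulrC.
  by apply: (hyp l m) => // l0; rewrite l0 eqxx in nzl.
have rE : r = - (l + m) by rewrite lm opprK.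
have [l0|{}nzl] := eqVneq l 0.
  apply: (classified_comb (s := g1) (u := (0, 0, 1))
    (v := (1, 0, 0)) (w := (0, 1, 0)) (d := 1) (tabP _)); rewrite ?oner_eq0 //.
    by rewrite /det3 /=; ring.
  by products; rewrite -?p_lm ?rE ?(nzl l0) ?l0; ring.
apply: (classified_comb (s := g3 (m / l)) (u := (1, 0, 0))
    (v := (- 1, 0, l^-1)) (w := (0, l^-1, 0)) (d := - l^-2) (tabP _)) => //.
- by rewrite /det3 /=; field.
- by rewrite oppr_eq0 invr_eq0 expf_neq0.
- by products; rewrite -?p_lm ?rE; field.
Qed.

(** Here e_3 = e_1 e_2, and e_3 exchanges the lines of e_1 and e_2. *)
Definition simple_form p q :=
  tab [:: (0, 1, (0, 0, 1)); (1, 0, (0, 0, - 1)); (0, 2, (0, q, 0)); (2, 0, (0, - q, 0));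
          (1, 2, (p, 0, 0)); (2, 1, (- p, 0, 0))] : structure K.

Lemma simple_form_classified p q : p != 0 -> q != 0 -> classified (simple_form p q).
Proof.
move=> nzp nzq; pose a := sqrtC (- q^-1); pose b := sqrtC p^-1.
have a2 : a ^+ 2 = - q^-1 by rewrite sqrtCK.
have b2 : b ^+ 2 = p^-1 by rewrite sqrtCK.
have nza : a != 0 by rewrite sqrtC_eq0 oppr_eq0 invr_eq0.
have nzb : b != 0 by rewrite sqrtC_eq0 invr_eq0.
have qE : q = - (a ^+ 2)^-1 by rewrite a2 invrN opprK invrK.
have pE : p = (b ^+ 2)^-1 by rewrite b2 invrK.
apply: (classified_comb (s := g4) (u := (a, 0, 0))
    (v := (0, b, 0)) (w := (0, 0, a * b)) (d := (a * b) ^+ 2) (tabP _)) => //.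
- by rewrite /det3 /=; ring.
- by rewrite expf_neq0 // mulf_neq0.
- by products; rewrite ?pE ?qE; field; rewrite ?nza ?nzb.
Qed.

(** The product x y = f(y) x - f(x) y, for the linear form f with coefficients
[a], [b], [c]. *)
Definition span_form a b c :=
  tab [:: (0, 1, (b, - a, 0)); (1, 0, (- b, a, 0)); (0, 2, (c, 0, - a)); (2, 0, (- c, 0, a));
          (1, 2, (0, c, - b)); (2, 1, (0, - c, b))] : structure K.

Lemma span_form_classified a b c : classified (span_form a b c).
Proof.
have [c0|nzc] := eqVneq c 0; last first.
  apply: (classified_comb (s := g2) (u := (1, 0, - a / c))
    (v := (0, 1, - b / c)) (w := (0, 0, c^-1)) (d := c^-1) (tabP _)); rewrite ?invr_eq0 //.
    by rewrite /det3 /=; field.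
  by products; field.
have [b0|nzb] := eqVneq b 0; last first.
  apply: (classified_comb (s := g2) (u := (1, - a / b, 0))
    (v := (0, 0, 1)) (w := (0, b^-1, 0)) (d := - b^-1) (tabP _)); rewrite ?oppr_eq0 ?invr_eq0 //.
    by rewrite /det3 /=; field.
  by products; rewrite ?c0; field.
have [a0|nza] := eqVneq a 0; last first.
  apply: (classified_comb (s := g2) (u := (0, 1, 0))
    (v := (0, 0, 1)) (w := (a^-1, 0, 0)) (d := a^-1) (tabP _)); rewrite ?invr_eq0 //.
    by rewrite /det3 /=; field.
  by products; rewrite ?c0 ?b0; field.
apply: (classified_comb (s := C3) (u := (1, 0, 0)) (v := (0, 1, 0)) (w := (0, 0, 1)) (d := 1)
  (tabP _)); rewrite ?oner_eq0 //.
  by rewrite /det3 /=; ring.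
by products; rewrite ?a0 ?b0 ?c0; ring.
Qed.
End NormalForms.

(** * Classification *)

Section Classification.
Variable K : numClosedFieldType.
Implicit Types (u v w x y z a b : 'cV[K]_3) (A B : structure K).

Definition det u v w := det3 (coords u) (coords v) (coords w).

Definition lin u v w (c : K * K * K) := c.1.1 *: u + c.1.2 *: v + c.2 *: w.

Lemma lin_vec u v w c : lin u v w c = vec (comb (coords u) (coords v) (coords w) c).
Proof. by rewrite /comb !vec_add !vec_scale !coordsK addrA. Qed.

Lemma lin_exists u v w x : det u v w != 0 -> exists c1 c2 c3, x = c1 *: u + c2 *: v + c3 *: w.
Proof.
move=> nzd; have [c xE] := coordinates (coords x) nzd.
by exists c.1.1, c.1.2, c.2; rewrite -[LHS]coordsK xE -lin_vec.
Qed.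

Lemma lin_eq0 u v w c1 c2 c3 : det u v w != 0 ->
  c1 *: u + c2 *: v + c3 *: w = 0 -> [/\ c1 = 0, c2 = 0 & c3 = 0].
Proof.
move=> nzd /= eq0; have U := cols3_unit nzd.
have : cols3 (coords u) (coords v) (coords w) *m vec (c1, c2, c3) = 0.
  by rewrite cols3_mul -lin_vec.
move/(congr1 (mulmx (invmx (cols3 (coords u) (coords v) (coords w))))).
rewrite mulKmx // mulmx0 => c0.
by split; [have := congr1 (fun M : 'cV_3 => M 0 0) c0
  | have := congr1 (fun M : 'cV_3 => M 1 0) c0
  | have := congr1 (fun M : 'cV_3 => M 2 0) c0]; rewrite vecE mxE.
Qed.

Definition unit3 (i : nat) : K * K * K :=
  nth (0, 0, 0) [:: (1, 0, 0); (0, 1, 0); (0, 0, 1)] i.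

Fixpoint tab_entry (s : seq (nat * nat * (K * K * K))) (i j : nat) : K * K * K :=
  if s is t :: s' then
    if (t.1.1 == i) && (t.1.2 == j) then add3 t.2 (tab_entry s' i j) else tab_entry s' i j
  else (0, 0, 0).

Lemma tab_entryE s i j : all (fun t => (t.1.1 < 3) && (t.1.2 < 3))%N s ->
  (i < 3)%N -> (j < 3)%N -> tab_prod s (unit3 i) (unit3 j) = tab_entry s i j.
Proof.
have entryE (k l : nat) : (k < 3)%N -> (l < 3)%N -> entry3 k (unit3 l) = (k == l)%:R.
  by case: k l => [|[|[|//]]] [|[|[|//]]].
move=> + lti ltj; elim: s => [|t s IH] //= /andP[/andP[lt1 lt2] /IH ->].
rewrite !entryE // -natrM mulnb /add3 /scale3.
case: ifP => _; rewrite ?mul1r ?mul0r ?add0r //.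
by case: (tab_entry s i j) => [[]].
Qed.

Lemma iso_tab A u v w s : det u v w != 0 ->
  all (fun t => (t.1.1 < 3) && (t.1.2 < 3))%N s ->
  (forall i j : nat, (i < 3)%N -> (j < 3)%N ->
     amul A (nth 0 [:: u; v; w] i) (nth 0 [:: u; v; w] j) =
     lin u v w (tab_entry s i j)) ->
  isomorphic A (tab s).
Proof.
move=> nzd ok prodE; apply: iso_sym.
pose g := cols3 (coords u) (coords v) (coords w).
have gE (i : 'I_3) : g *m evec K i = nth 0 [:: u; v; w] i.
  rewrite /g (_ : evec K i = vec (unit3 i)); last by elim/ord3P: i; apply: cV3P; rewrite !mxE.
  rewrite cols3_mul -lin_vec /lin.
  by elim/ord3P: i; rewrite /= !scale1r !scale0r ?addr0 ?add0r.
exists g => [|x y]; first exact: cols3_unit.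
rewrite [amul (tab s) x y]amul_expand {2}(cV3_sum x) {2}(cV3_sum y).
rewrite !mulmx_sumr amul_suml; apply: eq_bigr => i _.
rewrite mulmx_sumr amul_sumr; apply: eq_bigr => j _.
rewrite -!scalemxAr amulZl amulZr scalerA !gE prodE // -tab_entryE //.
rewrite lin_vec -cols3_mul -(tabP ok); congr (_ *: (_ *m amul _ _ _)).
  by elim/ord3P: i; apply: cV3P; rewrite !mxE.
by elim/ord3P: j; apply: cV3P; rewrite !mxE.
Qed.

Lemma classified_tab A u v w s : det u v w != 0 ->
  all (fun t => (t.1.1 < 3) && (t.1.2 < 3))%N s ->
  (forall i j : nat, (i < 3)%N -> (j < 3)%N ->
     amul A (nth 0 [:: u; v; w] i) (nth 0 [:: u; v; w] j) =
     lin u v w (tab_entry s i j)) ->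
  classified (tab s) -> classified A.
Proof. by move=> nzd ok prodE; apply/classified_iso/(iso_tab nzd ok prodE). Qed.

Section LeibnizAlgebra.
Variable A : structure K.
Hypothesis LA : leibniz A.
Local Notation "x ** y" := (amul A x y) (at level 40, left associativity).

Lemma amul_square x y : x ** (y ** y) = 0.
Proof.
by have := LA x y y => /eqP; rewrite -subr_eq0 opprD addNKr oppr_eq0 => /eqP.
Qed.

(** Polarization of the fact that squares are right annihilators. *)
Lemma amul_sym x y z : x ** (y ** z + z ** y) = 0.
Proof.
have := amul_square x (y + z); rewrite !bilin !amul_square add0r addr0.
by rewrite -!bilin addrC.
Qed.

Section Lie.
Hypothesis alt : forall x, x ** x = 0.

Lemma anti x y : x ** y = - (y ** x).
Proof.
have := alt (x + y); rewrite !bilin !alt add0r addr0 => /eqP.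
by rewrite addr_eq0 => /eqP.
Qed.

(** The three coordinates of the only Jacobi identity of a Lie algebra of
dimension three. *)
Lemma jacobi x y z p q r p' q' r' : x ** y = z -> det x y z != 0 ->
  x ** z = p *: x + q *: y + r *: z -> y ** z = p' *: x + q' *: y + r' *: z ->
  [/\ r' * p = r * p', r' * q = r * q' & p + q' = 0].
Proof.
move=> xy nzd xz yz.
have : (r' * p - r * p') *: x + (r' * q - r * q') *: y + (p + q') *: z = 0.
  have := LA x y z; rewrite xy alt xz yz !bilin !alt (anti z y) xy xz yz => ->.
  by vector.
by case/(lin_eq0 nzd) => /eqP + /eqP + ->; rewrite !subr_eq0 => /eqP -> /eqP ->.
Qed.

Lemma classified_solvable x y z : x ** y = z -> det x y z != 0 -> x ** z = 0 -> classified A.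
Proof.
move=> xy nzd xz; have [p [q [r yz]]] := lin_exists (y ** z) nzd.
have xz' : x ** z = 0 *: x + 0 *: y + 0 *: z by rewrite xz !scale0r !addr0.
have [_ _] := jacobi xy nzd xz' yz; rewrite add0r => q0.
apply: classified_tab nzd _ _ (solvable_form_classified p r) => //.
move=> [|[|[|//]]] [|[|[|//]]] _ _ /=;
  rewrite /lin /add3 /= ?alt ?xy ?(anti y x) ?(anti z x) ?(anti z y) ?xy ?xz ?yz ?q0;
  by vector.
Qed.

Lemma classified_simple x y z p q : x ** y = z -> det x y z != 0 ->
  x ** z = q *: y -> y ** z = p *: x -> p != 0 -> q != 0 -> classified A.
Proof.
move=> xy nzd xz yz nzp nzq.
apply: classified_tab nzd _ _ (simple_form_classified nzp nzq) => //.
move=> [|[|[|//]]] [|[|[|//]]] _ _ /=;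
  rewrite /lin /add3 /= ?alt ?xy ?(anti y x) ?(anti z x) ?(anti z y) ?xy ?xz ?yz;
  by vector.
Qed.

(** If z = x y annihilates a nonzero vector of the span of x and y, this vector
can play the role of x. *)
Lemma classified_kernel x y z c d : x ** y = z -> det x y z != 0 ->
  (c != 0) || (d != 0) -> (c *: x + d *: y) ** z = 0 -> classified A.
Proof.
move=> xy nzd nzcd Xz; have [c0|nzc] := eqVneq c 0.
  move: nzcd Xz; rewrite c0 eqxx scale0r add0r /= => nzd' Yz.
  apply: (classified_solvable (x := d *: y) (y := x) (z := (- d) *: z)).
  - by rewrite bilin anti xy scalerN scaleNr.
  - have -> : det (d *: y) x (- d *: z) = d ^+ 2 * det x y z.
      by rewrite /det /det3 /= !mxE; ring.
    by rewrite mulf_neq0 ?expf_neq0.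
  - by rewrite amulZr Yz scaler0.
apply: (classified_solvable (x := c *: x + d *: y) (y := y) (z := c *: z)).
- by rewrite !bilin alt xy scaler0 addr0.
- have -> : det (c *: x + d *: y) y (c *: z) = c ^+ 2 * det x y z.
    by rewrite /det /det3 /= !mxE; ring.
  by rewrite mulf_neq0 ?expf_neq0.
- by rewrite amulZr Xz scaler0.
Qed.

(** By the Jacobi identity, either z = x y annihilates a nonzero combination of x
and y, or z acts on their span by an invertible traceless matrix.  In the latter
case, a change of x or y removes the diagonal of the matrix. *)
Lemma classified_lie_independent x y : det x y (x ** y) != 0 -> classified A.
Proof.
set z := x ** y => nzd; have xy : x ** y = z by [].
have [p [q [r xz]]] := lin_exists (x ** z) nzd.
have [p' [q' [r' yz]]] := lin_exists (y ** z) nzd.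
have [rp rq pq'] := jacobi xy nzd xz yz.
have q'E : q' = - p by apply/eqP; rewrite -addr_eq0 addrC pq'.
have [nzr|/norP[]] := boolP ((r' != 0) || (r != 0)).
  (* this combination cancels the coordinate along z, and Jacobi does the rest *)
  apply: (classified_kernel (c := r') (d := - r) xy nzd); first by rewrite oppr_eq0.
  rewrite !bilin xz yz q'E; rewrite q'E in rq.
  have -> : r' *: (p *: x + q *: y + r *: z) + - r *: (p' *: x + - p *: y + r' *: z) =
    (r' * p - r * p') *: x + (r' * q - r * - p) *: y by vector.
  by rewrite rp rq !subrr !scale0r addr0.
rewrite !negbK => /eqP r'0 /eqP r0.
move: xz yz; rewrite r'0 r0 q'E scale0r !addr0 => xz yz {rp rq pq' q'E r0 r'0 r r' q'}.
have [d0|nzd'] := eqVneq (p ^+ 2 + q * p') 0.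
  (* a nilpotent traceless matrix has a nonzero kernel *)
  have [/andP[/eqP p'0 /eqP p0]|nz] := boolP ((p' == 0) && (p == 0)).
    apply: (classified_kernel (c := 0) (d := 1) xy nzd); first by rewrite oner_eq0 orbT.
    by rewrite scale0r add0r scale1r yz p'0 p0 oppr0 !scale0r addr0.
  apply: (classified_kernel (c := p') (d := - p) xy nzd).
    by rewrite oppr_eq0 -negb_and.
  rewrite !bilin xz yz.
  have -> : p' *: (p *: x + q *: y) + - p *: (p' *: x + - p *: y) =
    (p ^+ 2 + q * p') *: y by vector.
  by rewrite d0 scale0r.
have [q0|nzq] := eqVneq q 0; last first.
  apply: (classified_simple (x := x) (y := y + (p / q) *: x) (z := z)
    (p := (p ^+ 2 + q * p') / q) (q := q)) => //.
  - by rewrite !bilin alt scaler0 addr0.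
  - suff -> : det x (y + (p / q) *: x) z = det x y z by [].
    by rewrite /det /det3 /= !mxE; ring.
  - rewrite xz; apply: cV3P; rewrite !mxE; field; exact: nzq.
  - rewrite !bilin xz yz; apply: cV3P; rewrite !mxE; field; exact: nzq.
  - by rewrite mulf_neq0 ?invr_eq0.
have [p'0|nzp'] := eqVneq p' 0; last first.
  apply: (classified_simple (x := x - (p / p') *: y) (y := y) (z := z)
    (p := p') (q := (p ^+ 2 + q * p') / p')) => //.
  - by rewrite !bilin alt scaler0 oppr0 addr0.
  - suff -> : det (x - (p / p') *: y) y z = det x y z by [].
    by rewrite /det /det3 /= !mxE; ring.
  - rewrite !bilin xz yz; apply: cV3P; rewrite !mxE; field; exact: nzp'.
  - rewrite yz; apply: cV3P; rewrite !mxE; field; exact: nzp'.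
  - by rewrite mulf_neq0 ?invr_eq0.
move: nzd' xz yz; rewrite q0 p'0 mulr0 addr0 expf_eq0 /= !scale0r addr0 add0r => nzp xz yz.
have nz2 : (2 : K) != 0 by rewrite pnatr_eq0.
apply: (classified_simple (x := x + y) (y := x - y) (z := - 2 *: z)
    (p := - 2 * p) (q := - 2 * p)).
- by rewrite !bilin !alt (anti y x) xy; vector.
- have -> : det (x + y) (x - y) (- 2 *: z) = 4 * det x y z.
    by rewrite /det /det3 /= !mxE; ring.
  by rewrite mulf_neq0 ?pnatr_eq0.
- by rewrite !bilin xz yz; vector.
- by rewrite !bilin xz yz; vector.
- by rewrite mulf_neq0 ?oppr_eq0.
- by rewrite mulf_neq0 ?oppr_eq0.
Qed.

(** If every product is a combination of its factors, comparing the products of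
basis vectors with those of their sums gives a single linear form f with
x y = f(y) x - f(x) y. *)
Lemma classified_lie_span : (forall x y, det x y (x ** y) = 0) -> classified A.
Proof.
move=> span; pose E1 := evec K 0; pose E2 := evec K 1; pose E3 := evec K 2.
pose a := - (E1 ** E2) 1 0; pose b := (E1 ** E2) 0 0; pose c := (E1 ** E3) 0 0.
have nzd : det E1 E2 E3 != 0.
  have -> : det E1 E2 E3 = 1 by rewrite /det /det3 /= !mxE /=; ring.
  by rewrite oner_eq0.
have coordE : (E1 0 0 = 1) * (E1 1 0 = 0) * (E1 2 0 = 0) *
  ((E2 0 0 = 0) * (E2 1 0 = 1) * (E2 2 0 = 0)) * ((E3 0 0 = 0) * (E3 1 0 = 0) * (E3 2 0 = 1)).
  by rewrite !mxE.
have s12 := span E1 E2; have s13 := span E1 E3; have s23 := span E2 E3.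
have s1_23 := span E1 (E2 + E3); have s2_13 := span E2 (E1 + E3); have s12_3 := span (E1 + E2) E3.
move: s12 s13 s23 s1_23 s2_13 s12_3.
rewrite /det /det3 /= !bilin (anti E2 E1) !(coordD, coordN) !coordE.
rewrite !(oppr0, mulr0, mul0r, mulr1, mul1r, addr0, add0r, subr0, sub0r).
move=> e12_2 e13_1 e23_0; rewrite e12_2 e23_0 add0r oppr0 add0r addr0.
move=> /eqP; rewrite subr_eq0 => /eqP e13_2.
move=> /eqP; rewrite subr_eq0 eqr_oppLR => /eqP e23_2.
move=> /eqP; rewrite addrC subr_eq0 eq_sym => /eqP e23_1.
have {}e13_1 : (E1 ** E3) 1 0 = 0 by apply/eqP; rewrite -oppr_eq0 e13_1.
rewrite e13_1 addr0 in e13_2; rewrite e13_1 add0r addr0 in e23_1.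
have e12 : E1 ** E2 = b *: E1 - a *: E2.
  by apply: cV3P; rewrite coordD coordN !coordZ !coordE ?e12_2 /a /b; ring.
have e13 : E1 ** E3 = c *: E1 - a *: E3.
  by apply: cV3P; rewrite coordD coordN !coordZ !coordE ?e13_1 ?e13_2 /a /c; ring.
have e23 : E2 ** E3 = c *: E2 - b *: E3.
  by apply: cV3P; rewrite coordD coordN !coordZ !coordE ?e23_0 ?e23_1 ?e23_2 /b /c; ring.
clear e12_2 e13_1 e23_0 e13_2 e23_2 e23_1; clearbody a b c; clear span coordE; move: E1 E2 E3 nzd e12 e13 e23 => E1 E2 E3 nzd e12 e13 e23.
apply: classified_tab nzd _ _ (span_form_classified a b c) => //.
move=> [|[|[|//]]] [|[|[|//]]] _ _ /=;
  rewrite /lin /add3 /= ?alt ?(anti E2 E1) ?(anti E3 E1) ?(anti E3 E2) ?e12 ?e13 ?e23;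
  by vector.
Qed.

Lemma classified_lie : classified A.
Proof.
have [[x [y nzd]]|span] := pselect (exists x y, det x y (x ** y) != 0).
  exact: classified_lie_independent nzd.
apply: classified_lie_span => x y; apply/eqP/negPn/negP => nzd.
by apply: span; exists x, y.
Qed.
End Lie.

Section NotLie.
Variable a : 'cV[K]_3.
Local Notation u := (a ** a).
Hypothesis nzu : u != 0.

Lemma amul_u x : x ** u = 0. Proof. exact: amul_square. Qed.

(** For [v] in the right annihilator, [v ** x] is the symmetrized product of [v]
and [x]. *)
Lemma right_annihilator_mul v x : (forall y, y ** v = 0) -> forall y, y ** (v ** x) = 0.
Proof. by move=> vN y; have := amul_sym y v x; rewrite vN addr0. Qed.

(** The vector [a] is not in the right annihilator, since [a ** a] is not 0. *)
Lemma lin_annihilated c1 c2 c3 v : a ** v = 0 ->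
  a ** (c1 *: u + c2 *: v + c3 *: a) = 0 -> c3 = 0.
Proof.
move=> av; rewrite !bilin amul_u av !scaler0 !add0r => /eqP.
by rewrite scaler_eq0 (negPf nzu) orbF => /eqP.
Qed.

(** The right annihilator is the plane of u and v, since a is not in it, and it is
stable under right multiplications. *)
Lemma classified_right v : (forall x, x ** v = 0) -> det u v a != 0 -> classified A.
Proof.
move=> vN nzd.
have [m11 [m21 [c1 ua]]] := lin_exists (u ** a) nzd.
have [m12 [m22 [c2 va]]] := lin_exists (v ** a) nzd.
have c1_0 : c1 = 0.
  by have := right_annihilator_mul a amul_u a; rewrite ua => /(lin_annihilated (vN a)).
have c2_0 : c2 = 0 by have := right_annihilator_mul a vN a; rewrite va => /(lin_annihilated (vN a)).
apply: classified_tab nzd _ _ (right_form_classified m11 m21 m12 m22) => //.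
move=> [|[|[|//]]] [|[|[|//]]] _ _ /=;
  rewrite /lin /add3 /= ?amul_u ?vN ?ua ?va ?c1_0 ?c2_0; by vector.
Qed.

(** If [a] were proportional to u, then u = a a would vanish with a u. *)
Lemma exists_independent : exists b, det u b a != 0.
Proof.
apply: contrapT => dep.
have det0 b : det u b a = 0.
  by apply/eqP/negPn/negP => nz; apply: dep; exists b.
have [i nzi] : exists i, u i 0 != 0.
  apply: contrapT => u0; move/eqP: nzu; apply; apply/matrixP => i j; rewrite ord1 [RHS]mxE.
  by apply/eqP/negPn/negP => nzi; apply: u0; exists i.
have aE : u i 0 *: a = a i 0 *: u.
  have := det0 (evec K 0); have := det0 (evec K 1); have := det0 (evec K 2).
  rewrite /det /det3 /= ![evec _ _ _ _]mxE /=.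
  rewrite !(oppr0, mulr0, mul0r, mulr1, mul1r, addr0, add0r, subr0, sub0r).
  move=> /eqP; rewrite mulrN addrC subr_eq0 => /eqP e01.
  move=> /eqP; rewrite mulrN subr_eq0 => /eqP e02.
  move=> /eqP; rewrite oppr_eq0 subr_eq0 => /eqP e12.
  by elim/ord3P: (i); apply: cV3P; rewrite !coordZ;
    first [ring | ring: e12 | ring: e02 | ring: e01].
have /eqP : a ** (u i 0 *: a) = 0 by rewrite aE amulZr amul_u scaler0.
by rewrite amulZr scaler_eq0 (negPf nzi) (negPf nzu).
Qed.

Hypothesis line : forall v, (forall x, x ** v = 0) -> det u v a = 0.

(** By the hypothesis, the right annihilator lies in the plane of u and a, and [a]
is not in it. *)
Lemma annihilator_line v : (forall x, x ** v = 0) -> exists c, v = c *: u.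
Proof.
move=> vN; have [b nzd] := exists_independent; have [c1 [c2 [c3 vE]]] := lin_exists v nzd.
have c2_0 : c2 = 0.
  have /eqP : c2 * det u b a = 0.
    by rewrite -(line vN) vE /det /det3 /= !(coordD, coordZ); ring.
  by rewrite mulf_eq0 (negPf nzd) orbF => /eqP.
have /eqP : a ** v = 0 by [].
rewrite vE c2_0 !bilin amul_u !(scaler0, scale0r, add0r) scaler_eq0 (negPf nzu) orbF => /eqP ->.
by exists c1; rewrite !scale0r !addr0.
Qed.

(** Modulo u, all products vanish here.  If u x = f(x) u with f nonzero, the
identity (x y) z = (x z) y would put the kernel of f, which is a plane, in the
right annihilator. *)
Lemma classified_quotient_abelian b k r : det u b a != 0 ->
  b ** b = k *: u -> b ** a = r *: u -> classified A.
Proof.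
move=> nzd bb ba.
have [al ua] := annihilator_line (right_annihilator_mul a amul_u).
have [ga ub] := annihilator_line (right_annihilator_mul b amul_u).
have [ka abba] := annihilator_line (fun x => amul_sym x a b).
have ab : a ** b = (ka - r) *: u by rewrite scalerBl -abba ba addrK.
have inj e f : e *: u = f *: u -> e = f.
  by move/eqP; rewrite -subr_eq0 -scalerBl scaler_eq0 (negPf nzu) orbF subr_eq0 => /eqP.
have gaE : ga = (ka - r) * al.
  by apply: inj; have := LA a a b; rewrite ab ub !bilin ua amul_u scaler0 addr0 scalerA.
have rgaE : r * ga = k * al.
  by apply: inj; have := LA b a b; rewrite ab ba bb !bilin ub ua amul_u scaler0 addr0 !scalerA.
pose b' := al *: b - ga *: a.
have b'N x : x ** b' = 0.
  have [c1 [c2 [c3 ->]]] := lin_exists x nzd.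
  rewrite /b' !bilin ub ua bb ba ab.
  transitivity ((c2 * (k * al - r * ga) + c3 * ((ka - r) * al - ga)) *: u).
    by vector.
  by rewrite -rgaE -gaE !subrr !mulr0 addr0 scale0r.
have [c b'E] := annihilator_line b'N.
have [_ al0 ga0] : [/\ - c = 0, al = 0 & - ga = 0].
  apply: (lin_eq0 nzd); move: b'E; rewrite /b' => /eqP; rewrite -subr_eq0 => /eqP <-.
  by vector.
have {}ga0 : ga = 0 by apply/eqP; rewrite -oppr_eq0 ga0.
apply: classified_tab nzd _ _ (bilinear_form_classified k r (ka - r)) => //.
move=> [|[|[|//]]] [|[|[|//]]] _ _ /=;
  rewrite /lin /add3 /= ?amul_u ?ua ?ub ?ab ?ba ?bb ?al0 ?ga0; by vector.
Qed.

(** A change of the basis vector b makes d act on the left by -1, and the Leibniz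
identity then determines the remaining products up to three parameters. *)
Lemma classified_quotient_nonabelian b d e : det u b d != 0 ->
  b ** d = b + e *: u -> classified A.
Proof.
move=> nzd' bd.
have [ka bddb] := annihilator_line (fun x => amul_sym x b d).
have [al ud] := annihilator_line (right_annihilator_mul d amul_u).
have db : d ** b = - b + (ka - e) *: u.
  by apply: (addrI (b ** d)); rewrite bddb bd; vector.
have [c [nzd dc [r cd]]] : exists c, [/\ det u c d != 0, d ** c = - c
    & exists r, c ** d = c + r *: u].
  exists (b - (ka - e) *: u); split.
  - suff -> : det u (b - (ka - e) *: u) d = det u b d by [].
    by rewrite /det /det3 /= !(coordD, coordN, coordZ); ring.
  - by rewrite !bilin db amul_u; vector.
  - by exists (e + (ka - e) * (1 - al)); rewrite !bilin bd ud; vector.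
have [ga uc] := annihilator_line (right_annihilator_mul c amul_u).
have [k cc] := annihilator_line (amul_square^~ c).
have [m dd] := annihilator_line (amul_square^~ d).
have ga0 : ga = 0.
  have := LA u c d; rewrite uc ud cd !bilin uc amul_u ud => E.
  have /eqP : ga *: u = 0.
    transitivity (al *: (ga *: u) + (ga *: u + r *: 0) - ga *: (al *: u)); first by vector.
    by rewrite -E subrr.
  by rewrite scaler_eq0 (negPf nzu) orbF => /eqP.
have r0 : r = 0.
  have := LA d c d; rewrite dc dd cd !bilin uc ga0 dc amul_u cd => E.
  have /eqP : r *: u = 0.
    transitivity (m *: (0 *: u) + (- c + r *: 0) - - (c + r *: u)); first by vector.
    by rewrite -E subrr.
  by rewrite scaler_eq0 (negPf nzu) orbF => /eqP.
have kal : k * (al - 2) = 0.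
  have := LA c c d; rewrite cc cd r0 !bilin ud cc amul_u => E.
  have /eqP : (k * (al - 2)) *: u = 0.
    transitivity (k *: (al *: u) - (k *: u + 0 *: (u ** c) + (k *: u + 0 *: 0))).
      by vector.
    by rewrite E subrr.
  by rewrite scaler_eq0 (negPf nzu) orbF => /eqP.
apply: classified_tab nzd _ _ (nonabelian_form_classified m kal) => //.
move=> [|[|[|//]]] [|[|[|//]]] _ _ /=;
  rewrite /lin /add3 /= ?amul_u ?ud ?uc ?cc ?cd ?dc ?dd ?ga0 ?r0; by vector.
Qed.

(** The quotient by u is a Lie algebra of dimension two: if it is not abelian, the
product of b and a spans its derived algebra. *)
Lemma classified_line : classified A.
Proof.
have [b nzd] := exists_independent.
have [k bb] := annihilator_line (amul_square^~ b).
have [r [s [t ba]]] := lin_exists (b ** a) nzd.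
have [ka abba] := annihilator_line (fun x => amul_sym x a b).
have [s0|nzs] := eqVneq s 0; last first.
  apply: (classified_quotient_nonabelian (b := s *: b + t *: a) (d := s^-1 *: a) (e := r + t / s)).
    suff -> : det u (s *: b + t *: a) (s^-1 *: a) = det u b a by [].
    by rewrite /det /det3 /= !(coordD, coordZ); field.
  by rewrite !bilin ba; apply: cV3P; rewrite !(coordD, coordZ); field.
have [t0|nzt] := eqVneq t 0; last first.
  apply: (classified_quotient_nonabelian (b := t *: a) (d := - t^-1 *: b) (e := r - ka)).
    suff -> : det u (t *: a) (- t^-1 *: b) = det u b a by [].
    by rewrite /det /det3 /= !(coordD, coordZ); field.
  have ab : a ** b = ka *: u - b ** a by rewrite -abba addrK.
  by rewrite !bilin ab ba s0; apply: cV3P; rewrite !(coordD, coordN, coordZ); field.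
apply: (classified_quotient_abelian nzd bb (r := r)).
by rewrite ba s0 t0 !scale0r !addr0.
Qed.
End NotLie.

Lemma leibniz_classified : classified A.
Proof.
have [alt|] := pselect (forall x, x ** x = 0); first exact: classified_lie.
move/existsNP => [a /eqP nzu].
have [[v [vN nzd]]|none] := pselect (exists v, (forall x, x ** v = 0) /\ det (a ** a) v a != 0).
  exact: classified_right nzd.
apply: (classified_line nzu) => v vN; apply/eqP/negPn/negP => nzd.
by apply: none; exists v.
Qed.
End LeibnizAlgebra.
End Classification.

(** * The graph *)

Section Graph.
Variable K : numClosedFieldType.
Implicit Types (A B C : structure K) (s t u : symbol K).

Lemma path_listed s t B :
  listed s t -> directed_path (alg_of t) B -> directed_path (alg_of s) B.
Proof. by move=> st; apply: path_cons; exists s, t; split=> //; exact: iso_refl. Qed.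

Lemma path_refl A : directed_path A A.
Proof. exact/path_nil/iso_refl. Qed.

Lemma listed_path s t : listed s t -> directed_path (alg_of s) (alg_of t).
Proof. by move/path_listed; apply; exact: path_refl. Qed.

(** The isomorphism at the end of the first path is absorbed by the first edge of
the second one. *)
Lemma path_trans A B C : directed_path A B -> directed_path B C -> directed_path A C.
Proof.
move=> AB; elim: AB C => {A B} [A B AB C BC | A A' B AA' _ IH C BC]; last first.
  exact: path_cons AA' (IH _ BC).
case: BC AB => {B C} [B C BC AB | B B' C [s [t [st Bs B't]]] B'C AB].
  exact: path_nil (iso_trans AB BC).
by apply: path_cons B'C; exists s, t; split=> //; exact: iso_trans Bs.
Qed.

Lemma path_degenerates A B : directed_path A B -> degenerates A B.
Proof.
elim=> {A B} [A B /iso_degenerates // | A B C [s [t [st As Bt]]] _ BC].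
apply: degenerates_trans (iso_degenerates As) _.
apply: degenerates_trans (listed_degenerates st) _.
exact: degenerates_trans (iso_degenerates (iso_sym Bt)) BC.
Qed.

Lemma reach_path s t : reach s t -> directed_path (alg_of s) (alg_of t).
Proof.
have L1L2 (b : K) : directed_path (alg_of (L1 b)) (alg_of L2) by apply: listed_path; exact: L1_L2.
have L3L2 : directed_path (alg_of (@L3 K)) (alg_of L2) by apply: listed_path; exact: L3_L2.
have L4L1 (a b : K) : (2 - a) ^+ 2 * b = 1 - a -> directed_path (alg_of (L4 a)) (alg_of (L1 b)).
  move=> ab; have a2 : a != 2.
    apply/eqP => a2; move/eqP: ab; rewrite a2 subrr expr0n mul0r eq_sym subr_eq0.
    by rewrite -[X in X == _]/(1%:R) eqr_nat.
  have nz : (2 - a) ^+ 2 != 0 by rewrite expf_neq0 // subr_eq0 eq_sym.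
  have -> : b = (1 - a) / (2 - a) ^+ 2 by rewrite -ab mulrC mulKf.
  apply: listed_path; exact: L4_L1.
have L42L3 : directed_path (alg_of (L4 (2 : K))) (alg_of L3) by apply: listed_path; exact: L4_L3.
have L4L2 (a : K) : directed_path (alg_of (L4 a)) (alg_of L2).
  have [->|a2] := eqVneq a 2; first exact: path_trans L42L3 L3L2.
  by apply: (path_trans _ (L1L2 ((1 - a) / (2 - a) ^+ 2))); apply: listed_path; exact: L4_L1.
have L5L4 : directed_path (alg_of (@L5 K)) (alg_of (L4 2)) by apply: listed_path; exact: L5_L4.
have L8L1 : directed_path (alg_of (@L8 K)) (alg_of (L1 0)) by apply: listed_path; exact: L8_L1.
have L6L8 (a : K) : a <> 0 -> a <> 1 -> directed_path (alg_of (L6 a)) (alg_of L8).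
  by move=> /eqP a0 /eqP a1; apply: listed_path; exact: L6_L8.
have L6L1 (a : K) : a <> 1 -> directed_path (alg_of (L6 a)) (alg_of (L1 0)).
  have [-> _|/eqP a0 a1] := eqVneq a 0; first by apply: listed_path; exact: L6_L1.
  exact: path_trans (L6L8 _ a0 a1) L8L1.
have L6L2 (a : K) : directed_path (alg_of (L6 a)) (alg_of L2).
  have [->|/eqP a1] := eqVneq a 1; first by apply: listed_path; exact: L6_L2.
  exact: path_trans (L6L1 _ a1) (L1L2 0).
have L7L8 : directed_path (alg_of (@L7 K)) (alg_of L8) by apply: listed_path; exact: L7_L8.
have L9L8 : directed_path (alg_of (@L9 K)) (alg_of L8) by apply: listed_path; exact: L9_L8.
have L8L2 : directed_path (alg_of (@L8 K)) (alg_of L2) by exact: path_trans L8L1 (L1L2 0).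
have L5L3 : directed_path (alg_of (@L5 K)) (alg_of L3) by exact: path_trans L5L4 L42L3.
have g3g1 (a : K) : directed_path (alg_of (g3 a)) (alg_of g1) by apply: listed_path; exact: g3_g1.
have L40g3 : directed_path (alg_of (L4 (0 : K))) (alg_of (g3 0)) by apply: listed_path; exact: L4_g3.
have g4g3 : directed_path (alg_of (@g4 K)) (alg_of (g3 (-1))) by apply: listed_path; exact: g4_g3.
have L2C3 : directed_path (alg_of (@L2 K)) (alg_of C3) by apply: listed_path; exact: L2_C3.
have g1C3 : directed_path (alg_of (@g1 K)) (alg_of C3) by apply: listed_path; exact: g1_C3.
have g2C3 : directed_path (alg_of (@g2 K)) (alg_of C3) by apply: listed_path; exact: g2_C3.
have rr := path_refl.
have L5L2 := path_trans L5L3 L3L2; have L7L2 := path_trans L7L8 L8L2.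
have L9L2 := path_trans L9L8 L8L2; have g4g1 := path_trans g4g3 (g3g1 _).
have toC3 (v : symbol K) : directed_path (alg_of v) (alg_of C3).
  case: v => [|||a||a|||a||a|||]; first [exact: rr | exact: g1C3 | exact: g2C3
    | by apply: (path_trans _ g1C3); auto | by apply: (path_trans _ L2C3); auto].
case: s t => [|||a||a|||a||a|||] [|||b||b|||b||b|||];
  rewrite /reach; try first [by case | by move=> _; first [exact: rr | exact: toC3 | auto]].
- by move=> ->; apply: listed_path; exact: g3_g2.
- by case=> [->|ab]; [exact: rr | exact/path_nil/iso_g3].
- by move=> ->; exact: g4g3.
- by move=> ->; apply: listed_path; exact: L1_g1.
- by move=> ->; exact: rr.
- by move=> ->; exact: path_trans L40g3 (g3g1 0).
- by case=> -> ->; exact: L40g3.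
- exact: L4L1.
- by move=> ->; exact: L42L3.
- by move=> ->; exact: rr.
- by move=> ->; exact: L5L4.
- by case=> a1 ->; exact: L6L1.
- by case=> [->|ab]; [exact: rr | exact/path_nil/iso_L6].
- by case; exact: L6L8.
- by move=> ->; exact: path_trans L7L8 L8L1.
- by move=> ->; apply: listed_path; exact: L7_L6.
- by move=> ->; exact: L8L1.
- by move=> ->; exact: path_trans L9L8 L8L1.
- by move=> ->; apply: listed_path; exact: L9_L6.
Qed.

(** No edge is the composition of two others. *)
Lemma listed_between s t u : listed s t -> reach s u -> reach u t ->
  isomorphic (alg_of s) (alg_of u) \/ isomorphic (alg_of u) (alg_of t).
Proof.
have isoL6 (a b : K) : a = b \/ a * b = 1 -> isomorphic (alg_of (L6 a)) (alg_of (L6 b)).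
  by case=> [->|/iso_L6 //]; exact: iso_refl.
have isog3 (a b : K) : a = b \/ a * b = 1 -> isomorphic (alg_of (g3 a)) (alg_of (g3 b)).
  by case=> [->|/iso_g3 //]; exact: iso_refl.
have ir (v : symbol K) : isomorphic (alg_of v) (alg_of v) by exact: iso_refl.
case=> [|a a0 a1||||| a a2 | | | | | | b | | | | a | | | |]; case: u => [|||c||c|||c||c|||];
  rewrite /reach; try first [by case | by move=> _ [] | by move=> *; left; auto | by move=> *; right; auto].
all: first
  [ by move=> -> _; left; exact: ir | by move=> -> _; right; exact: ir
  | by move=> _ <-; right; exact: ir | by move=> <- _; left; exact: ir
  | by move=> [_ ->] _; right; exact: ir | by move=> -> [] ].
Qed.

Lemma iso_forget_param s t :
  isomorphic (alg_of s) (alg_of t) -> forget_param s = forget_param t.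
Proof.
move=> st; have := degenerates_reach (iso_degenerates st).
have := degenerates_reach (iso_degenerates (iso_sym st)).
by case: s t {st} => [|||a||a|||a||a|||] [|||b||b|||b||b|||].
Qed.
Lemma listed_not_iso s t : listed s t -> ~ isomorphic (alg_of s) (alg_of t).
Proof. by move=> st /iso_forget_param; case: st. Qed.

Lemma degenerates_leibniz A B : leibniz A -> degenerates A B -> leibniz B.
Proof. by move=> /leibnizP LA AB; apply/leibnizP/(degenerates_satisfies AB). Qed.

Lemma degenerates_pathP A B : leibniz A -> leibniz B ->
  degenerates A B <-> directed_path A B.
Proof.
move=> /leibniz_classified[s As] /leibniz_classified[t Bt]; split; last exact: path_degenerates.
move=> AB; have {}AB : degenerates (alg_of s) (alg_of t).
  apply: degenerates_trans (iso_degenerates (iso_sym As)) _.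
  exact: degenerates_trans AB (iso_degenerates Bt).
apply: path_trans (path_nil As) _; apply: path_trans (path_nil (iso_sym Bt)).
exact/reach_path/degenerates_reach.
Qed.

Lemma primary_edgeP A B : leibniz A -> leibniz B ->
  primary_degeneration A B <-> edge A B.
Proof.
have edge_not_iso C D : edge C D -> ~ isomorphic C D.
  move=> [s [t [st Cs Dt]]] CD; apply: (listed_not_iso st).
  exact: iso_trans (iso_sym Cs) (iso_trans CD Dt).
move=> LA LB; split=> [[[AB nAB] noC] | edgeAB].
  have pathAB := (degenerates_pathP LA LB).1 AB.
  case: pathAB nAB noC {LA LB AB} => [C D CD /(_ CD) // | C C' D CC' C'D _ noC].
  have [C'iD|nC'D] := pselect (isomorphic C' D).
    have [s [t [st Cs C't]]] := CC'; exists s, t; split=> //.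
    exact: iso_trans (iso_sym C'iD) C't.
  case: noC; exists C'; split; split=> //; last exact: path_degenerates.
    exact: path_degenerates (path_cons CC' (path_refl _)).
  exact: edge_not_iso.
split.
  split; last exact: edge_not_iso.
  exact: path_degenerates (path_cons edgeAB (path_refl _)).
have [s [t [st As Bt]]] := edgeAB; case=> C [[AC nAC] [CB nCB]].
have [u Cu] := leibniz_classified (degenerates_leibniz LA AC).
have su : reach s u.
  apply: degenerates_reach.
  apply: degenerates_trans (iso_degenerates (iso_sym As)) _.
  exact: degenerates_trans AC (iso_degenerates Cu).
have ut : reach u t.
  apply: degenerates_reach.
  apply: degenerates_trans (iso_degenerates (iso_sym Cu)) _.
  exact: degenerates_trans CB (iso_degenerates Bt).
case: (listed_between st su ut) => [isu|iut].
  by apply: nAC; exact: iso_trans As (iso_trans isu (iso_sym Cu)).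
by apply: nCB; exact: iso_trans Cu (iso_trans iut (iso_sym Bt)).
Qed.
End Graph.

Theorem theorem4 (R : realType) :
  [/\ forall A : structure R[i],
        leibniz A <-> exists s : symbol R[i], isomorphic A (alg_of s),
      forall s t : symbol R[i],
        isomorphic (alg_of s) (alg_of t) -> forget_param s = forget_param t,
      forall A B : structure R[i], leibniz A -> leibniz B ->
        (primary_degeneration A B <-> edge A B)
    & forall A B : structure R[i], leibniz A -> leibniz B ->
        (degenerates A B <-> directed_path A B)].
Proof.
split.
- move=> A; split=> [LA | [s As]]; first exact: leibniz_classified LA.
  apply/leibnizP/(degenerates_satisfies (iso_degenerates (iso_sym As))).
  exact: leibniz_alg.
- exact: iso_forget_param.
- exact: primary_edgeP.
- exact: degenerates_pathP.
Qed.
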